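(* Consider the stochastic block model with fixed $K$ described in the context, and assume that $B_0$ is full rank. Fix any $q>0$. Then there exist constants $c$ and $n_0$ that depend only on $B_0$, $\pi_1,\dots,\pi_K$ and $q$ such that if $n\ge n_0$ and $$n\rho_n\ge c\log n,$$ then spectral clustering using the adjacency matrix achieves exact recovery with probability at least $1-n^{-q}$.
   Context: Stochastic block model: $K$ is fixed, each $i\in[n]=\{1,\dots,n\}$ has a label $c_i\in[K]$, $n_r=|\{i:c_i=r\}|$ with $n_r/n\to\pi_r$ for fixed $\pi_1,\dots,\pi_K>0$ summing to $1$; $B=\rho_nB_0\in[0,1]^{K\times K}$ with $B_0$ a fixed symmetric matrix and $\rho_n>0$ a rate function. The adjacency matrix $A$ is symmetric with $A_{ii}=0$ and $(A_{ij})_{i<j}$ independent with $A_{ij}\sim\mathrm{Ber}(B_{c_ic_j})$. Spectral clustering using the adjacency matrix: let $U\in\mathbb R^{n\times K}$ have as columns orthonormal eigenvectors of $A$ corresponding to its $K$ largest eigenvalues in absolute value, with rows $U_1^{T},\dots,U_n^{T}$; apply $K$-medians, i.e. let $(\hat v_1,\dots,\hat v_K)$ minimize $\frac1n\sum_{i=1}^n\min_{r\in[K]}\|U_i-v_r\|_2$ over $(v_1,\dots,v_K)$, and output $\hat c_i=\arg\min_r\|U_i-\hat v_r\|_2$. Exact recovery is the event that there is a permutation $\pi$ of the labels $[K]$ with $\hat c_i=\pi(c_i)$ for all $i\in[n]$.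
   Formalization: The threshold n_0 is allowed to depend, besides B_0, π_1,…,π_K and q, on a rate ε_n→0 bounding |n_r/n−π_r|; without this the claim fails, since convergence says nothing about the labels at a single n. The constant c depends only on B_0, π and q. *)

(* Defs.v *)
From HB Require Import structures.
From mathcomp Require Import all_boot all_order all_algebra all_fingroup.
From mathcomp Require Import all_classical all_reals all_analysis.

Set Implicit Arguments.
Unset Strict Implicit.
Unset Printing Implicit Defensive.

Import Order.TTheory GRing.Theory Num.Theory.
Import numFieldNormedType.Exports.

Local Open Scope classical_set_scope.
Local Open Scope ring_scope.

Section SpectralClustering.
Context {R : realType}.

(* The library norm on matrices is the sup norm, hence this definition. *)
Definition enorm k (u : 'rV[R]_k) : R := Num.sqrt (\sum_j u 0 j ^+ 2).

(* V is a full orthonormal eigenbasis (in columns), so eigenvalues are counted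
   with multiplicity; f selects K of them that dominate all the others in
   absolute value. Ties and the order of the K columns are left free. *)
Definition top_eigenvectors n K (A : 'M[R]_n) (U : 'M[R]_(n, K)) : Prop :=
  exists (V : 'M[R]_n) (lambda : 'rV[R]_n) (f : 'I_K -> 'I_n),
    [/\ V^T *m V = 1%:M,
        A *m V = V *m diag_mx lambda,
        injective f,
        forall k j, j \notin codom f -> `|lambda 0 j| <= `|lambda 0 (f k)|
      & U = colsub f V].

(* For K > 0 the infimum ranges over a finite nonempty set, so it is a min. *)
Definition kmedians_cost n k K (U : 'M[R]_(n, k)) (v : 'I_K -> 'rV[R]_k) : R :=
  n%:R^-1 * \sum_(i < n) inf (range (fun r => enorm (row i U - v r))).

Definition kmedians n k K (U : 'M[R]_(n, k)) (v : 'I_K -> 'rV[R]_k) : Prop :=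
  forall w : 'I_K -> 'rV[R]_k, kmedians_cost U v <= kmedians_cost U w.

(* A relation rather than a function: eigenvectors, minimizers and nearest
   centers need not be unique, and every admissible choice gives an output. For
   symmetric A and 0 < K <= n there is always one, by the spectral theorem and
   compactness. *)
Definition spectral_clustering n K (A : 'M[R]_n) (chat : 'I_n -> 'I_K) : Prop :=
  exists (U : 'M[R]_(n, K)) (v : 'I_K -> 'rV[R]_K),
    [/\ top_eigenvectors A U,
        kmedians U v
      & forall i r, enorm (row i U - v (chat i)) <= enorm (row i U - v r)].

End SpectralClustering.

Definition exact_recovery n K (c chat : 'I_n -> 'I_K) : Prop :=
  exists s : 'S_K, forall i, chat i = s (c i).

Definition block_size n K (c : 'I_n -> 'I_K) (r : 'I_K) : nat :=
  #|[set i | c i == r]%SET|.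

Definition mutually_independent d d' (T : measurableType d)
    (T' : measurableType d') (R : realType) (P : probability T R)
    (I : finType) (D : {set I}) (X : I -> {RV P >-> T'}) : Prop :=
  forall J : {set I}, J \subset D ->
  forall E : I -> set T', (forall i, measurable (E i)) ->
    P (\bigcap_(i in [set` J]) (X i @^-1` E i)) =
    (\big[mule/1]_(i in J) P (X i @^-1` E i))%E.

Section SBM.
Context d (T : measurableType d) (R : realType) (P : probability T R).
Variables (n K : nat) (c : 'I_n -> 'I_K) (B : 'M[R]_K).
Variable E : 'I_n -> 'I_n -> {RV P >-> bool}.

Definition adjacency (w : T) : 'M[R]_n := \matrix_(i, j) (E i j w)%:R.

Record stochastic_block_model : Prop := StochasticBlockModel {
  sbm_sym : forall w i j, E i j w = E j i w;
  sbm_diag : forall w i, E i i w = false;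
  sbm_law : forall i j : 'I_n, (i < j)%N ->
    distribution P (E i j) =1 bernoulli_prob (B (c i) (c j));
  sbm_indep : mutually_independent [set e : 'I_n * 'I_n | (e.1 < e.2)%N]%SET
    (fun e => E e.1 e.2) }.

(* Success whatever the choices made by the algorithm. *)
Definition spectral_recovery_event : set T :=
  [set w | forall chat : 'I_n -> 'I_K,
    spectral_clustering (adjacency w) chat -> exact_recovery c chat].

End SBM.

(* Main.v *)
Require Import Defs.
From HB Require Import structures.
From mathcomp Require Import all_boot all_order all_algebra all_fingroup.
From mathcomp Require Import all_classical all_reals all_analysis.
From mathcomp Require Import ring lra zify.

Set Implicit Arguments.
Unset Strict Implicit.
Unset Printing Implicit Defensive.

Import Order.TTheory GRing.Theory Num.Theory.
Import numFieldNormedType.Exports.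

Local Open Scope ring_scope.

(** The adjacency matrix A is compared with the matrix P of edge probabilities,
    which is constant on pairs of blocks. Write N = n rho and W = A - P. Since B0
    is invertible and the blocks have linear size, P has rank K and its nonzero
    eigenvalues are of order N.

    - Operator norm. If N >= c log n with c large, then |W| <= eta N for a constant
      eta as small as desired. A Chernoff bound controls W summed over pairs of
      vertex sets of comparable sizes, the degrees control the other pairs, and
      bilinear_discrepancy turns this discrepancy bound into a bound on bilinear
      forms. Losing a constant factor here is harmless, because only a small
      multiple of N is needed and not the optimal square root of N.

    - Eigenspaces. A dimension count (top_eigenvectors_split) shows that the K
      selected eigenvalues of A are of order N and that the others are at most
      eta N. The matrix U of the selected eigenvectors satisfies A U = U L, hence
      U = P U L^-1 + W U L^-1. The first term is constant on blocks and gives one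
      center per block, and the distances between the centers are at least of order
      n^(-1/2) (center_separation). Exact recovery by K-medians follows
      (kmedians_exact_recovery) if every row of W U is at most a small multiple of
      N n^(-1/2).

    - Rows of W U. The difficulty is that U depends on the i-th row of W. Among the
      well-behaved graphs that agree with the given one away from vertex i, one is
      chosen by a rule that does not look at the edges at i; let X be its leading
      eigenvectors. Then row i of W is independent of X, and row i of W X is small
      by the Chernoff bound. Both graphs are close to P and differ only at vertex
      i, so by sin_theta the distance from U to the span of X is at most a constant
      times the largest row of U, and multiplying it by row i of W costs only
      eta N (leave_one_out_row). So row i of W U is small compared to N times the
      largest row of U, and since U is close to a block-constant matrix this
      estimate closes on itself (row_bootstrap).

    All the events only involve the finitely many edges, so the probabilities are
    computed under a finite product of Bernoulli laws and transferred to the given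
    probability space at the end. *)

(** * The Frobenius norm *)

Section FrobeniusNorm.
Context {R : rcfType}.

Definition fnorm m n (A : 'M[R]_(m, n)) : R :=
  Num.sqrt (\sum_i \sum_j A i j ^+ 2).

Lemma fnorm_ge0 m n (A : 'M[R]_(m, n)) : 0 <= fnorm A.
Proof. exact: sqrtr_ge0. Qed.

Lemma sqr_fnorm m n (A : 'M[R]_(m, n)) :
  fnorm A ^+ 2 = \sum_i \sum_j A i j ^+ 2.
Proof.
by rewrite sqr_sqrtr//; do 2![apply: sumr_ge0 => ? _]; apply: sqr_ge0.
Qed.

Lemma fnorm_trmx m n (A : 'M[R]_(m, n)) : fnorm A^T = fnorm A.
Proof.
rewrite /fnorm exchange_big/=; congr Num.sqrt.
by apply: eq_bigr => i _; apply: eq_bigr => j _; rewrite mxE.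
Qed.

Lemma sqr_fnorm_tr m n (A : 'M[R]_(m, n)) : fnorm A ^+ 2 = \tr (A^T *m A).
Proof.
rewrite sqr_fnorm exchange_big /mxtrace; apply: eq_bigr => j _.
by rewrite mxE; apply: eq_bigr => i _; rewrite mxE expr2.
Qed.

Lemma fnorm0 m n : fnorm (0 : 'M[R]_(m, n)) = 0.
Proof.
by rewrite /fnorm !big1 ?sqrtr0// => i _; rewrite big1// => j _; rewrite mxE expr0n.
Qed.

Lemma fnorm_eq0 m n (A : 'M[R]_(m, n)) : fnorm A = 0 -> A = 0.
Proof.
move=> A0; have := sqr_fnorm A; rewrite A0 expr0n/= => /esym/eqP.
rewrite psumr_eq0; last by move=> i _; apply: sumr_ge0 => j _; apply: sqr_ge0.
move=> /allP Ai; apply/matrixP => i j; rewrite mxE.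
have := Ai i (mem_index_enum _); rewrite implyTb psumr_eq0; last first.
  by move=> k _; apply: sqr_ge0.
by move=> /allP /(_ j (mem_index_enum _)); rewrite implyTb sqrf_eq0 => /eqP.
Qed.

Lemma fnorm_gt0 m n (A : 'M[R]_(m, n)) : A != 0 -> 0 < fnorm A.
Proof. by rewrite lt_def fnorm_ge0 andbT; apply: contraNneq => /fnorm_eq0 ->. Qed.

Lemma fnormZ m n a (A : 'M[R]_(m, n)) : fnorm (a *: A) = `|a| * fnorm A.
Proof.
rewrite /fnorm -sqrtr_sqr -sqrtrM ?sqr_ge0// mulr_sumr; congr Num.sqrt.
apply: eq_bigr => i _; rewrite mulr_sumr.
by apply: eq_bigr => j _; rewrite mxE exprMn.
Qed.

Lemma fnormN m n (A : 'M[R]_(m, n)) : fnorm (- A) = fnorm A.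
Proof. by rewrite -scaleN1r fnormZ normrN normr1 mul1r. Qed.

Lemma fnormBC m n (A B : 'M[R]_(m, n)) : fnorm (A - B) = fnorm (B - A).
Proof. by rewrite -fnormN opprB. Qed.

Lemma cauchy_schwarz_sum (I : finType) (a b : I -> R) :
  (\sum_i a i * b i) ^+ 2 <= (\sum_i a i ^+ 2) * (\sum_i b i ^+ 2).
Proof.
set A := \sum_i a i ^+ 2; set B := \sum_i b i ^+ 2; set C := \sum_i a i * b i.
have B0 : 0 <= B by apply: sumr_ge0 => i _; apply: sqr_ge0.
have H : 0 <= \sum_i (B * a i - C * b i) ^+ 2.
  by apply: sumr_ge0 => i _; apply: sqr_ge0.
have E : \sum_i (B * a i - C * b i) ^+ 2 = B * (A * B - C ^+ 2).
  have sq i : (B * a i - C * b i) ^+ 2 =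
    B ^+ 2 * a i ^+ 2 + (- (2 * B * C)) * (a i * b i) + C ^+ 2 * b i ^+ 2.
    by ring.
  under eq_bigr do rewrite sq.
  by rewrite !big_split/= -!mulr_sumr -/A -/B -/C; ring.
move: B0; rewrite le_eqVlt => /predU1P[B0|B0]; last first.
  by move: H; rewrite E pmulr_rge0// subr_ge0.
have b0 i : b i = 0.
  have /esym/eqP := B0; rewrite psumr_eq0; last by move=> ? _; apply: sqr_ge0.
  by move=> /allP /(_ i (mem_index_enum _)); rewrite implyTb sqrf_eq0 => /eqP.
by rewrite -B0 mulr0 /C big1 ?expr0n// => i _; rewrite b0 mulr0.
Qed.

Lemma fnormM m n p (A : 'M[R]_(m, n)) (B : 'M[R]_(n, p)) :
  fnorm (A *m B) <= fnorm A * fnorm B.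
Proof.
rewrite -ler_sqr ?nnegrE ?mulr_ge0 ?fnorm_ge0// exprMn !sqr_fnorm.
rewrite mulr_suml; apply: ler_sum => i _.
rewrite exchange_big mulr_sumr/=; apply: ler_sum => j _.
by rewrite mxE; exact: cauchy_schwarz_sum.
Qed.

Lemma fnormD m n (A B : 'M[R]_(m, n)) : fnorm (A + B) <= fnorm A + fnorm B.
Proof.
rewrite -ler_sqr ?nnegrE ?addr_ge0 ?fnorm_ge0// sqrrD !sqr_fnorm.
have -> : \sum_i \sum_j (A + B) i j ^+ 2 = \sum_i \sum_j A i j ^+ 2 +
    (\sum_i \sum_j A i j * B i j) *+ 2 + \sum_i \sum_j B i j ^+ 2.
  rewrite -sumrMnl -!big_split; apply: eq_bigr => i _ /=.
  rewrite -sumrMnl -!big_split; apply: eq_bigr => j _ /=.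
  by rewrite mxE sqrrD.
rewrite lerD2r lerD2l lerMn2r/= (le_trans (ler_norm _))//.
rewrite -ler_sqr ?nnegrE ?mulr_ge0 ?fnorm_ge0// real_normK ?num_real//.
rewrite exprMn !sqr_fnorm !pair_big.
exact: (cauchy_schwarz_sum (fun p : 'I_m * 'I_n => A p.1 p.2) (fun p => B p.1 p.2)).
Qed.

Lemma fnormB m n (A B : 'M[R]_(m, n)) : fnorm (A - B) <= fnorm A + fnorm B.
Proof. by rewrite -(fnormN B) fnormD. Qed.

Lemma fnorm_dist m n (A B C : 'M[R]_(m, n)) :
  fnorm (A - C) <= fnorm (A - B) + fnorm (B - C).
Proof. by rewrite -[A - C](subrKA B) fnormD. Qed.

Lemma sqr_fnorm_rows m n (A : 'M[R]_(m, n)) :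
  fnorm A ^+ 2 = \sum_i fnorm (row i A) ^+ 2.
Proof.
rewrite sqr_fnorm; apply: eq_bigr => i _; rewrite sqr_fnorm big_ord1.
by apply: eq_bigr => j _; rewrite mxE.
Qed.

Lemma fnorm_row_le m n (A : 'M[R]_(m, n)) i : fnorm (row i A) <= fnorm A.
Proof.
rewrite -ler_sqr ?nnegrE ?fnorm_ge0// (sqr_fnorm_rows A) (bigD1 i)//= lerDl.
by apply: sumr_ge0 => j _; apply: sqr_ge0.
Qed.

Lemma normr_entry_le m n (A : 'M[R]_(m, n)) i j : `|A i j| <= fnorm (row i A).
Proof.
rewrite -ler_sqr ?nnegrE ?fnorm_ge0// real_normK ?num_real// sqr_fnorm big_ord1.
rewrite (bigD1 j)//= mxE lerDl.
by apply: sumr_ge0 => k _; apply: sqr_ge0.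
Qed.

Lemma fnorm_sum (I : Type) (r : seq I) (Q : pred I) m n (F : I -> 'M[R]_(m, n)) :
  fnorm (\sum_(i <- r | Q i) F i) <= \sum_(i <- r | Q i) fnorm (F i).
Proof.
elim/big_rec2: _ => [|i x A _ IH]; first by rewrite fnorm0.
by rewrite (le_trans (fnormD _ _))// lerD2l.
Qed.

Lemma fnorm_le_rows m n (A : 'M[R]_(m, n)) : fnorm A <= \sum_i fnorm (row i A).
Proof.
have s0 : 0 <= \sum_i fnorm (row i A) by apply: sumr_ge0 => i _; apply: fnorm_ge0.
rewrite -ler_sqr ?nnegrE ?fnorm_ge0// sqr_fnorm_rows expr2 mulr_suml.
apply: ler_sum => i _; rewrite expr2 ler_wpM2l ?fnorm_ge0//.
by rewrite (bigD1 i)//= lerDl; apply: sumr_ge0 => j _; apply: fnorm_ge0.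
Qed.

Lemma row_mulmx m n p (A : 'M[R]_(m, n)) (B : 'M[R]_(n, p)) i :
  row i (A *m B) = \sum_j A i j *: row j B.
Proof. by rewrite row_mul mulmx_sum_row; apply: eq_bigr => j _; rewrite mxE. Qed.

Lemma fnorm_row_mul m n p (A : 'M[R]_(m, n)) (B : 'M[R]_(n, p)) i u :
  (forall j, fnorm (row j B) <= u) ->
  fnorm (row i (A *m B)) <= (\sum_j `|A i j|) * u.
Proof.
move=> Bu; rewrite row_mulmx (le_trans (fnorm_sum _ _ _))// mulr_suml.
by apply: ler_sum => j _; rewrite fnormZ ler_wpM2l.
Qed.

Lemma fnorm_isometry n k p (U : 'M[R]_(n, k)) (Y : 'M[R]_(k, p)) :
  U^T *m U = 1%:M -> fnorm (U *m Y) = fnorm Y.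
Proof.
move=> U1; apply/eqP; rewrite -(eqrXn2 (n := 2))// ?fnorm_ge0//.
by rewrite !sqr_fnorm_tr trmx_mul mulmxA -(mulmxA Y^T) U1 mulmx1.
Qed.

Lemma pythagoras n k p (U : 'M[R]_(n, k)) (Y : 'M[R]_(n, p)) :
  U^T *m U = 1%:M ->
  fnorm Y ^+ 2 = fnorm (U^T *m Y) ^+ 2 + fnorm (Y - U *m (U^T *m Y)) ^+ 2.
Proof.
move=> U1; set H := U^T *m Y; set D := Y - _.
have UD : U^T *m D = 0 by rewrite mulmxBr mulmxA U1 mul1mx subrr.
have DU : D^T *m U = 0 by rewrite -[LHS]trmxK trmx_mul trmxK UD trmx0.
have -> : Y = D + U *m H by rewrite subrK.
clearbody D H; rewrite !sqr_fnorm_tr [(_ + _)^T]linearD/= mulmxDl !mulmxDr.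
rewrite trmx_mul (mulmxA D^T) DU mul0mx -(mulmxA H^T U^T D) UD mulmx0 addr0 add0r.
by rewrite -(mulmxA H^T U^T) (mulmxA U^T) U1 mul1mx linearD addrC.
Qed.

Lemma fnorm_trmulmx_le n k p (U : 'M[R]_(n, k)) (Y : 'M[R]_(n, p)) :
  U^T *m U = 1%:M -> fnorm (U^T *m Y) <= fnorm Y.
Proof.
move=> U1; rewrite -ler_sqr ?nnegrE ?fnorm_ge0// (pythagoras Y U1) lerDl.
exact: sqr_ge0.
Qed.

Lemma fnorm_proj_le n k p (U : 'M[R]_(n, k)) (Y : 'M[R]_(n, p)) :
  U^T *m U = 1%:M -> fnorm (Y - U *m (U^T *m Y)) <= fnorm Y.
Proof.
move=> U1; rewrite -ler_sqr ?nnegrE ?fnorm_ge0// (pythagoras Y U1) lerDr.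
exact: sqr_ge0.
Qed.

Lemma sqr_fnorm_orthonormal n k (U : 'M[R]_(n, k)) :
  U^T *m U = 1%:M -> fnorm U ^+ 2 = k%:R.
Proof. by move=> U1; rewrite sqr_fnorm_tr U1 mxtrace1. Qed.

Lemma fnorm_diag_ge n p (l : 'rV[R]_n) (Y : 'M[R]_(n, p)) t : 0 <= t ->
  (forall i j, Y i j != 0 -> t <= `|l 0 i|) ->
  t * fnorm Y <= fnorm (diag_mx l *m Y).
Proof.
move=> t0 tl; rewrite -ler_sqr ?nnegrE ?mulr_ge0 ?fnorm_ge0// exprMn !sqr_fnorm.
rewrite mulr_sumr; apply: ler_sum => i _; rewrite mulr_sumr; apply: ler_sum => j _.
rewrite mul_diag_mx mxE exprMn.
have [->|Y0] := eqVneq (Y i j) 0; first by rewrite expr0n !mulr0.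
rewrite ler_wpM2r ?sqr_ge0// -[leRHS]real_normK ?num_real//.
by rewrite lerXn2r ?nnegrE//; apply: tl Y0.
Qed.

Lemma fnorm_diag_le n p (l : 'rV[R]_n) (Y : 'M[R]_(n, p)) t : 0 <= t ->
  (forall i j, Y i j != 0 -> `|l 0 i| <= t) ->
  fnorm (diag_mx l *m Y) <= t * fnorm Y.
Proof.
move=> t0 tl; rewrite -ler_sqr ?nnegrE ?mulr_ge0 ?fnorm_ge0// exprMn !sqr_fnorm.
rewrite mulr_sumr; apply: ler_sum => i _; rewrite mulr_sumr; apply: ler_sum => j _.
rewrite mul_diag_mx mxE exprMn.
have [->|Y0] := eqVneq (Y i j) 0; first by rewrite expr0n !mulr0.
rewrite ler_wpM2r ?sqr_ge0// -[leLHS]real_normK ?num_real//.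
by rewrite lerXn2r ?nnegrE//; apply: tl Y0.
Qed.

End FrobeniusNorm.

(** * Leading eigenspaces of a perturbed low rank matrix *)

Section SpectralSplit.
Context {R : rcfType}.

(** What is used of the leading eigenvectors: the columns of U span an invariant
    subspace on which A is bounded below by lo, and A is bounded above by hi on
    its orthogonal complement. *)
Definition spectral_split n K (A : 'M[R]_n) (U : 'M[R]_(n, K)) (l : 'rV[R]_K)
    (lo hi : R) : Prop :=
  [/\ U^T *m U = 1%:M,
      A *m U = U *m diag_mx l,
      forall k, lo <= `|l 0 k|
    & forall m (Y : 'M[R]_(n, m)), U^T *m Y = 0 ->
        fnorm (A *m Y) <= hi * fnorm Y].

Definition opnorm_le n (W : 'M[R]_n) (h : R) : Prop :=
  forall m (Y : 'M[R]_(n, m)), fnorm (W *m Y) <= h * fnorm Y.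

Lemma mulmx_nontrivial_kernel b a (M : 'M[R]_(b, a)) : (b < a)%N ->
  exists2 u : 'cV[R]_a, u != 0 & M *m u = 0.
Proof.
move=> ba; have : kermx M^T != 0.
  by rewrite kermx_eq0 /row_free mxrank_tr neq_ltn (leq_ltn_trans (rank_leq_row M)).
move=> /rowV0Pn[v /sub_kermxP vM v0]; exists v^T; first by rewrite trmx_eq0.
by apply: trmx_inj; rewrite trmx_mul trmxK vM trmx0.
Qed.

Lemma colsub_orthonormal n k (V : 'M[R]_n) (g : 'I_k -> 'I_n) :
  V^T *m V = 1%:M -> injective g -> (colsub g V)^T *m colsub g V = 1%:M.
Proof.
move=> V1 gI; apply/matrixP => i j; rewrite !mxE.
transitivity ((V^T *m V) (g i) (g j)).
  by rewrite mxE; apply: eq_bigr => k' _; rewrite !mxE.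
by rewrite V1 mxE (inj_eq gI).
Qed.

Lemma mul_colsub_eigen n k (A V : 'M[R]_n) (lambda : 'rV[R]_n) (g : 'I_k -> 'I_n) :
  A *m V = V *m diag_mx lambda ->
  A *m colsub g V = colsub g V *m diag_mx (colsub g lambda).
Proof.
move=> AV; apply/matrixP => i j; rewrite mul_mx_diag !mxE.
transitivity ((A *m V) i (g j)); last by rewrite AV mul_mx_diag mxE.
by rewrite mxE; apply: eq_bigr => k' _; rewrite !mxE.
Qed.

(** The two bounds come from the same dimension count. If a leading eigenvalue
    were too small, at most K - 1 eigenvectors would have a large one, and some
    nonzero vector of the K-dimensional range of P would be orthogonal to all of
    them. If a trailing eigenvalue were too large, K + 1 eigenvectors would have
    a large one, and some nonzero combination of them would be killed by P. *)
Lemma top_eigenvectors_split n K (A P V : 'M[R]_n) (lambda : 'rV[R]_n)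
    (f : 'I_K -> 'I_n) (Z : 'M[R]_(n, K)) (M : 'M[R]_(n, K)) (g h : R) :
  A^T = A -> V^T *m V = 1%:M -> A *m V = V *m diag_mx lambda -> injective f ->
  (forall k j, j \notin codom f -> `|lambda 0 j| <= `|lambda 0 (f k)|) ->
  P = M *m Z^T -> 0 <= h -> opnorm_le (A - P) h ->
  (forall y : 'cV[R]_K, Z *m y = 0 -> y = 0) ->
  (forall y : 'cV[R]_K, g * fnorm (Z *m y) <= fnorm (P *m (Z *m y))) ->
  spectral_split A (colsub f V) (colsub f lambda) (g - h) h.
Proof.
move=> Asym V1 AV fI top PE h0 Wh Zinj Pg.
have V1' : V *m V^T = 1%:M by exact: mulmx1C.
have VtA : V^T *m A = diag_mx lambda *m V^T.
  by apply: trmx_inj; rewrite !trmx_mul trmxK Asym AV tr_diag_mx.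
have fnA m (Y : 'M[R]_(n, m)) : fnorm (A *m Y) = fnorm (diag_mx lambda *m (V^T *m Y)).
  rewrite mulmxA -VtA -mulmxA -(fnorm_isometry (A *m Y) (_ : V^T^T *m V^T = 1%:M))//.
  by rewrite trmxK.
have fnV m (Y : 'M[R]_(n, m)) : fnorm (V^T *m Y) = fnorm Y.
  by rewrite fnorm_isometry// trmxK.
have VtE m (Y : 'M[R]_(n, m)) k j : (V^T *m Y) (f k) j = ((colsub f V)^T *m Y) k j.
  by rewrite !mxE; apply: eq_bigr => i _; rewrite !mxE.
split.
- exact: colsub_orthonormal.
- exact: mul_colsub_eigen.
- move=> k; rewrite mxE.
  case: K f Z M fI top PE Zinj Pg VtE k => [|K] f Z M fI top PE Zinj Pg VtE k.
    by case: k.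
  have [y y0 Uy] := mulmx_nontrivial_kernel
    ((colsub (f \o lift k) V)^T *m Z) (ltnSn K).
  set x := Z *m y.
  have x0 : x != 0 by apply: contraNneq y0 => /Zinj ->.
  have xf k' : k' != k -> forall j, (V^T *m x) (f k') j = 0.
    rewrite eq_sym => /unlift_some[k'' -> _] j.
    move/matrixP: Uy => /(_ k'' j); rewrite -mulmxA [RHS]mxE => <-.
    by rewrite !mxE; apply: eq_bigr => i _; rewrite !mxE.
  have Ax : fnorm (A *m x) <= `|lambda 0 (f k)| * fnorm x.
    rewrite fnA -(fnV _ x); apply: fnorm_diag_le => // i j.
    have [/codomP[k' ->]|/top -/(_ k)//] := boolP (i \in codom f).
    by have [->//|/xf ->] := eqVneq k' k; rewrite eqxx.
  rewrite -(ler_pM2r (fnorm_gt0 x0)) mulrBl (le_trans _ Ax)// lerBlDr.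
  rewrite (le_trans (Pg y))// -/x (_ : P *m x = A *m x - (A - P) *m x).
    by rewrite (le_trans (fnormB _ _))// lerD2l; exact: Wh.
  by rewrite mulmxBl opprB addrC subrK.
move=> m Y UY; rewrite fnA -(fnV _ Y); apply: fnorm_diag_le => // j j'.
have [/codomP[k' ->]|jf _] := boolP (j \in codom f).
  by rewrite VtE UY mxE eqxx.
pose e (i : 'I_K.+1) := oapp f j (unlift ord0 i).
have eI : injective e.
  move=> i i'; rewrite /e.
  case: (unliftP ord0 i) => [k ->|->]; case: (unliftP ord0 i') => [k' ->|->] //=.
  - by move=> /fI ->.
  - by move=> fk; move: jf; rewrite -fk codom_f.
  - by move=> fk; move: jf; rewrite fk codom_f.
have [u u0 Zu] := mulmx_nontrivial_kernel (Z^T *m colsub e V) (ltnSn K).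
have e1 := colsub_orthonormal V1 eI.
set x := colsub e V *m u.
have Ax : A *m x = (A - P) *m x.
  by rewrite mulmxBl PE -mulmxA [Z^T *m x]mulmxA Zu mulmx0 subr0.
rewrite -(ler_pM2r (fnorm_gt0 u0)) -[X in _ <= _ * X](fnorm_isometry _ e1).
rewrite (le_trans _ (Wh _ _))// -Ax mulmxA (mul_colsub_eigen _ AV) -mulmxA.
rewrite fnorm_isometry//; apply: fnorm_diag_ge => // i i' _; rewrite mxE /e.
by case: (unliftP ord0 i) => [k _|_] //=; exact: top.
Qed.

End SpectralSplit.

(** * Rows of the leading eigenvectors *)

Section RowBounds.
Context {R : rcfType}.

(** The residual D = U - X X^T U satisfies the Sylvester-type equation
    A' D - D diag l = (1 - X X^T) (A' - A) U, in which the right factor is at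
    least lo and A' is at most hi on the columns of D. *)
Lemma sin_theta n K (A A' : 'M[R]_n) (U X : 'M[R]_(n, K)) (l l' : 'rV[R]_K)
    (lo hi : R) :
  A'^T = A' -> 0 <= lo ->
  spectral_split A U l lo hi -> spectral_split A' X l' lo hi ->
  (lo - hi) * fnorm (U - X *m (X^T *m U)) <= fnorm ((A' - A) *m U).
Proof.
move=> A's lo0 [U1 AU ll _] [X1 A'X _ A'hi].
set H := X^T *m U; set D := U - X *m H.
have XD : X^T *m D = 0 by rewrite mulmxBr mulmxA X1 mul1mx subrr.
have XA'D : X^T *m (A' *m D) = 0.
  have -> : X^T *m (A' *m D) = (A' *m X)^T *m D by rewrite trmx_mul A's mulmxA.
  by rewrite A'X trmx_mul -mulmxA XD mulmx0.
pose S := (A' - A) *m U.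
have E : A' *m D - D *m diag_mx l = S - X *m (X^T *m S).
  have E1 : A' *m D - D *m diag_mx l =
      S - X *m (diag_mx l' *m H - H *m diag_mx l).
    rewrite /D /S !mulmxBr !mulmxBl AU (mulmxA A') A'X -!mulmxA.
    by rewrite !opprD !opprK !addrA; congr (_ + _); rewrite addrAC.
  rewrite E1; congr (S - X *m _).
  have : X^T *m (A' *m D - D *m diag_mx l) = 0.
    by rewrite mulmxBr XA'D mulmxA XD mul0mx subrr.
  by rewrite E1 mulmxBr (mulmxA X^T X) X1 mul1mx => /eqP; rewrite subr_eq0 => /eqP.
have := fnorm_proj_le S X1; rewrite -E => le_S.
rewrite mulrBl lerBlDr.
have lD : lo * fnorm D <= fnorm (D *m diag_mx l).
  rewrite -(fnorm_trmx D) -(fnorm_trmx (D *m _)) trmx_mul tr_diag_mx.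
  by apply: fnorm_diag_ge => // i j _.
rewrite (le_trans lD)// -[D *m _](subKr (A' *m D)) (le_trans (fnormB _ _))//.
by rewrite addrC lerD// A'hi.
Qed.

(** When the two eigenspaces are close, X^T U is nearly orthogonal and cannot
    shrink a row of X by more than a factor 2. *)
Lemma fnorm_row_transfer n K (U X : 'M[R]_(n, K)) i :
  X^T *m X = 1%:M -> U^T *m U = 1%:M ->
  fnorm (X - U *m (U^T *m X)) <= 2^-1 ->
  fnorm (row i X) <= 2 * fnorm (row i (X *m (X^T *m U))).
Proof.
move=> X1 U1 D2; set x := row i X; set D := X - _ in D2.
have := pythagoras (X *m x^T) U1.
have -> : X *m x^T - U *m (U^T *m (X *m x^T)) = D *m x^T.
  by rewrite mulmxBl !mulmxA.
rewrite fnorm_isometry// fnorm_trmx.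
have -> : fnorm (U^T *m (X *m x^T)) = fnorm (row i (X *m (X^T *m U))).
  by rewrite row_mul -/x -fnorm_trmx !trmx_mul !trmxK mulmxA.
set z := fnorm (row i (X *m _)) => E.
have Dx : fnorm (D *m x^T) <= 2^-1 * fnorm x.
  rewrite (le_trans (fnormM _ _))// fnorm_trmx ler_wpM2r ?fnorm_ge0//.
have := fnorm_ge0 (D *m x^T).
have := fnorm_ge0 x; have z0 : 0 <= z := fnorm_ge0 _.
move: Dx E; set a := fnorm x; set b := fnorm (D *m x^T) => ba E a0 b0.
have : b ^+ 2 <= (2^-1 * a) ^+ 2 by rewrite lerXn2r ?nnegrE ?mulr_ge0 ?invr_ge0.
move=> b2; rewrite -ler_sqr ?nnegrE ?mulr_ge0 ?fnorm_ge0//.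
have := sqr_ge0 z; move: b2 E; rewrite !exprMn => b2 E z2; lra.
Qed.

(** Leave-one-out. In the application A' shares with A everything but the i-th row
    and column, and X does not depend on row i of A; this is what makes tau small.
    The part X X^T U of U is handled by tau. The rest has norm at most C u by
    sin_theta, because (A' - A) U is bounded by the total mass of A' - A times the
    largest row of U, and it meets row i of A - P, whose norm is at most hi. *)
Lemma leave_one_out_row n K (A A' P : 'M[R]_n) (U X : 'M[R]_(n, K))
    (l l' : 'rV[R]_K) (lo hi g u tau s C : R) i :
  A^T = A -> A'^T = A' ->
  spectral_split A U l lo hi -> spectral_split A' X l' lo hi ->
  opnorm_le (A - P) hi -> opnorm_le (A' - P) hi ->
  0 < g -> 0 <= lo -> 0 <= hi -> 0 <= tau -> 0 <= C -> g <= lo - hi ->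
  16 * hi ^+ 2 * K%:R <= g ^+ 2 ->
  \sum_a \sum_b `|(A' - A) a b| <= C * g ->
  (forall j, fnorm (row j U) <= u) ->
  (forall m, (forall j, fnorm (row j X) <= m) ->
     fnorm (row i ((A - P) *m X)) <= tau * (s + m)) ->
  fnorm (row i ((A - P) *m U)) <= tau * (s + 2 * (1 + C) * u) + hi * (C * u).
Proof.
move=> As A's sU sX Wh W'h g0 lo0 hi0 tau0 C0 gle crude AA' Uu tauP.
have [U1 _ _ _] := sU; have [X1 _ _ _] := sX.
have u0 : 0 <= u by rewrite (le_trans _ (Uu i))// fnorm_ge0.
set D := U - X *m (X^T *m U).
have DC : fnorm D <= C * u.
  have := sin_theta A's lo0 sU sX; rewrite -/D => st.
  rewrite -(ler_pM2l g0) (le_trans (ler_wpM2r (fnorm_ge0 _) gle))//.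
  rewrite (le_trans st)// (le_trans (fnorm_le_rows _))//.
  rewrite mulrA [g * C]mulrC (le_trans _ (ler_wpM2r u0 AA'))// mulr_suml.
  by apply: ler_sum => a _; exact: fnorm_row_mul.
have D2 : fnorm (X - U *m (U^T *m X)) <= 2^-1.
  have st := sin_theta As lo0 sX sU.
  have hX : fnorm ((A - A') *m X) <= 2 * hi * fnorm X.
    have -> : A - A' = (A - P) - (A' - P) by rewrite opprB addrA subrK.
    by rewrite mulmxBl (le_trans (fnormB _ _))// -mulrA mulr_natl mulr2n lerD.
  rewrite -(ler_pM2l g0) (le_trans (ler_wpM2r (fnorm_ge0 _) gle))//.
  rewrite (le_trans st)// (le_trans hX)//.
  rewrite -ler_sqr ?nnegrE ?mulr_ge0 ?fnorm_ge0 ?invr_ge0 ?(ltW g0)//.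
  rewrite exprMn (sqr_fnorm_orthonormal X1).
  have -> : (2 * hi) ^+ 2 * K%:R = 16 * hi ^+ 2 * K%:R / 4 by field.
  have -> : (g * 2^-1) ^+ 2 = g ^+ 2 / 4 by field.
  by rewrite ler_wpM2r ?invr_ge0.
have Xm j : fnorm (row j X) <= 2 * (1 + C) * u.
  rewrite (le_trans (fnorm_row_transfer j X1 U1 D2))// -mulrA ler_wpM2l//.
  have -> : X *m (X^T *m U) = U - D by rewrite subKr.
  rewrite linearB/= (le_trans (fnormB _ _))// mulrDl mul1r lerD//.
  by rewrite (le_trans (fnorm_row_le _ _)).
have -> : U = X *m (X^T *m U) + D by rewrite addrC subrK.
rewrite mulmxDr linearD/= (le_trans (fnormD _ _))// lerD//.
  rewrite (le_trans _ (tauP _ Xm))// mulmxA (row_mul i (_ *m X)).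
  rewrite -(fnorm_trmx (_ *m (X^T *m U))) !trmx_mul trmxK -mulmxA.
  by rewrite (le_trans (fnorm_trmulmx_le _ U1))// fnorm_isometry// fnorm_trmx.
by rewrite (le_trans (fnorm_row_le _ _))// (le_trans (Wh _ _))// ler_wpM2l.
Qed.

(** The leave-one-out bound controls the rows of (A - P) U by the largest row of
    U, and U = A U diag l ^-1 controls the latter by the former; the product of
    the two constants is below 1/2, so both can be bounded. *)
Lemma row_bootstrap n K (A P : 'M[R]_n) (U : 'M[R]_(n, K)) (l : 'rV[R]_K)
    (lo hi p tau beta s : R) :
  spectral_split A U l lo hi -> 0 < lo -> 0 <= s -> 0 <= beta ->
  0 <= p -> 0 <= tau ->
  (forall i, fnorm (row i P) <= p * s) -> beta <= lo / 2 ->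
  (forall u, (forall j, fnorm (row j U) <= u) ->
     forall i, fnorm (row i ((A - P) *m U)) <= tau * s + beta * u) ->
  forall i, fnorm (row i ((A - P) *m U)) <=
            (tau + beta * (2 * (p + tau) / lo)) * s.
Proof.
move=> [U1 AU ll _] lo0 s0 beta0 p0 tau0 Pp blo boot i.
pose u := \big[Order.max/0]_j fnorm (row j U).
have Uu j : fnorm (row j U) <= u by exact: le_bigmax.
have u0 : 0 <= u by apply: le_trans (Uu i); apply: fnorm_ge0.
have rowU j : lo * fnorm (row j U) <= p * s + (tau * s + beta * u).
  have : lo * fnorm (row j U) <= fnorm (row j (A *m U)).
    rewrite AU row_mul -(fnorm_trmx (row j U)) -(fnorm_trmx (_ *m _)) trmx_mul tr_diag_mx.
    by apply: fnorm_diag_ge; [exact: ltW|move=> ? ? _; exact: ll].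
  move=> /le_trans; apply.
  have -> : A *m U = P *m U + (A - P) *m U by rewrite mulmxBl addrC subrK.
  rewrite linearD/= (le_trans (fnormD _ _))// lerD// ?boot//.
  rewrite row_mul -(fnorm_trmx (_ *m U)) trmx_mul (le_trans (fnorm_trmulmx_le _ U1))//.
  by rewrite fnorm_trmx.
have lou : lo * u <= p * s + (tau * s + beta * u).
  rewrite mulrC -ler_pdivlMr//; apply: bigmax_le => [|j _].
    by rewrite divr_ge0 ?addr_ge0 ?mulr_ge0// ltW.
  by rewrite ler_pdivlMr// mulrC.
have us : u <= 2 * (p + tau) / lo * s.
  rewrite mulrAC ler_pdivlMr//; nra.
rewrite (le_trans (boot _ Uu i))// mulrDl lerD2l -mulrA ler_wpM2l//.
Qed.

(** Q acts as an inverse of P on w. The component of w orthogonal to U is then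
    small, and C differs from U by (A - P) U diag l ^-1, so w^T C is almost as long
    as w. *)
Lemma center_separation n K (A P Q : 'M[R]_n) (U C : 'M[R]_(n, K)) (l : 'rV[R]_K)
    (lo hi : R) (w : 'cV[R]_n) :
  A^T = A -> P^T = P -> spectral_split A U l lo hi -> opnorm_le (A - P) hi ->
  0 <= hi -> 0 < lo -> P *m (Q *m w) = w -> 8 * hi * fnorm Q <= 1 ->
  4 * hi <= lo -> C *m diag_mx l = P *m U ->
  fnorm w <= 2 * fnorm (w^T *m C).
Proof.
move=> As Ps [U1 AU ll Ahi] Wh hi0 lo0 PQw hQ hlo CE.
have UtA : U^T *m A = diag_mx l *m U^T.
  by apply: trmx_inj; rewrite !trmx_mul trmxK As AU tr_diag_mx.
set z := Q *m w in PQw.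
have zw : fnorm z <= fnorm Q * fnorm w by exact: fnormM.
have Yle : fnorm (w - U *m (U^T *m w)) <= 4^-1 * fnorm w.
  have -> : w - U *m (U^T *m w) = A *m (z - U *m (U^T *m z))
      - ((A - P) *m z - U *m (U^T *m ((A - P) *m z))).
    rewrite mulmxBl PQw !mulmxBr (mulmxA A U) AU (mulmxA U^T A) UtA -!mulmxA.
    move: (A *m z) (U *m (diag_mx l *m _)) (U *m (U^T *m w)) => a b v.
    by rewrite opprB -(addrA b) subrKA opprB addrCA (addrCA a) subrr addr0 addrC.
  rewrite (le_trans (fnormB _ _))//.
  have p1 : fnorm (A *m (z - U *m (U^T *m z))) <= hi * fnorm z.
    rewrite (le_trans (Ahi _ _ _)) ?ler_wpM2l ?fnorm_proj_le//.
    by rewrite mulmxBr (mulmxA U^T U) U1 mul1mx subrr.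
  have p2 := le_trans (fnorm_proj_le ((A - P) *m z) U1) (Wh _ z).
  rewrite (le_trans (lerD p1 p2))//.
  have := ler_wpM2l hi0 zw; have := ler_wpM2r (fnorm_ge0 w) hQ.
  rewrite mul1r -!mulrA; lra.
have UCle : fnorm (w^T *m (U - C)) <= 4^-1 * fnorm w.
  rewrite -(ler_pM2l lo0); apply: (@le_trans _ _ (fnorm (w^T *m (U - C) *m diag_mx l))).
    rewrite -(fnorm_trmx (_ *m (U - C))) -(fnorm_trmx (_ *m diag_mx l)).
    rewrite (trmx_mul _ (diag_mx l)) tr_diag_mx.
    by apply: fnorm_diag_ge; [exact: ltW|move=> ? ? _; exact: ll].
  rewrite -mulmxA mulmxBl CE -AU -mulmxBl mulmxA.
  rewrite -(fnorm_trmx (_ *m U)) !trmx_mul (le_trans (fnorm_trmulmx_le _ U1))//.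
  rewrite linearB/= As Ps trmxK (le_trans (Wh _ _))//.
  have := ler_wpM2r (fnorm_ge0 w) hlo; lra.
have wU : fnorm w <= fnorm (w^T *m U) + 4^-1 * fnorm w.
  rewrite -{1}[w](subrK (U *m (U^T *m w))) addrC (le_trans (fnormD _ _))// lerD//.
  by rewrite fnorm_isometry// -(fnorm_trmx (U^T *m w)) trmx_mul trmxK.
have wUC : fnorm (w^T *m U) <= fnorm (w^T *m C) + 4^-1 * fnorm w.
  have -> : w^T *m U = w^T *m C + w^T *m (U - C) by rewrite mulmxBr addrC subrK.
  by rewrite (le_trans (fnormD _ _))// lerD2l.
lra.
Qed.

End RowBounds.

(** * From discrepancy to the operator norm *)

Section Discrepancy.
Context {R : realType}.

(** A linear form on a cube is largest at a vertex: S1 and S2 collect the indices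
    where g is nonnegative and negative. *)
Lemma linear_form_vertex (I : finType) (S : {set I}) (u g : I -> R) (a : R) :
  0 <= a -> (forall i, i \in S -> `|u i| <= a) ->
  exists S1 S2 : {set I}, [/\ S1 \subset S, S2 \subset S &
    \sum_(i in S) u i * g i <= a * (\sum_(i in S1) g i - \sum_(i in S2) g i)].
Proof.
move=> a0 ua; exists [set i in S | 0 <= g i], [set i in S | ~~ (0 <= g i)].
split; try by apply/fintype.subsetP => i; rewrite inE => /andP[].
rewrite (bigID (fun i => 0 <= g i))/= mulrBr -mulrN -sumrN !mulr_sumr.
rewrite [X in _ <= X + _](eq_bigl (fun i => (i \in S) && (0 <= g i))); last first.
  by move=> i; rewrite inE.
rewrite [X in _ <= _ + X](eq_bigl (fun i => (i \in S) && ~~ (0 <= g i))); last first.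
  by move=> i; rewrite inE.
apply: lerD; apply: ler_sum => i /andP[/ua ui gi].
  by rewrite ler_wpM2r// (le_trans (ler_norm _)).
have {}gi : 0 <= - g i by rewrite oppr_ge0 ltW// ltNge.
rewrite -(mulrNN (u i)) ler_wpM2r//.
by rewrite (le_trans (ler_norm _)) ?normrN.
Qed.

Definition discrepancy_le n (W : 'M[R]_n) (alpha : R) : Prop :=
  forall S T : {set 'I_n}, `|\sum_(i in S) \sum_(j in T) W i j| <=
    alpha * Num.sqrt (#|S|%:R * #|T|%:R).

(** Discrepancy for vertices of the boxes extends to all their points, one factor
    at a time; the 4 counts the signs of the two factors. *)
Lemma discrepancy_box n (W : 'M[R]_n) (alpha a b : R) (S T : {set 'I_n})
    (u v : 'I_n -> R) :
  0 <= alpha -> discrepancy_le W alpha -> 0 <= a -> 0 <= b ->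
  (forall i, i \in S -> `|u i| <= a) -> (forall j, j \in T -> `|v j| <= b) ->
  `|\sum_(i in S) \sum_(j in T) u i * W i j * v j| <=
    4 * a * b * (alpha * Num.sqrt (#|S|%:R * #|T|%:R)).
Proof.
move=> al0 disc a0 b0 ua vb; set B := alpha * _.
have sub (S1 T1 : {set 'I_n}) : S1 \subset S -> T1 \subset T ->
    `|\sum_(i in S1) \sum_(j in T1) W i j| <= B.
  move=> SS TT; rewrite (le_trans (disc _ _))// ler_wpM2l// ler_wsqrtr//.
  by rewrite ler_pM// ler_nat subset_leq_card.
suff main (w : 'I_n -> R) : (forall i, i \in S -> `|w i| <= a) ->
    \sum_(i in S) \sum_(j in T) w i * W i j * v j <= 4 * a * b * B.
  rewrite ler_norml main// andbT lerNl -sumrN.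
  have := main (fun i => - u i); under eq_bigr => i iS do under eq_bigr => j jT
    do rewrite 2!mulNr.
  under eq_bigr => i iS do rewrite sumrN.
  by apply => i iS; rewrite normrN ua.
move=> wa; pose g i := \sum_(j in T) W i j * v j.
have [S1 [S2 [S1S S2S le1]]] := linear_form_vertex g a0 wa.
pose h j := \sum_(i in S1) W i j - \sum_(i in S2) W i j.
have [T1 [T2 [T1T T2T le2]]] := linear_form_vertex h b0 vb.
have gh : \sum_(i in S1) g i - \sum_(i in S2) g i = \sum_(j in T) v j * h j.
  rewrite exchange_big/= [X in _ - X]exchange_big/= -sumrB; apply: eq_bigr => j _.
  by rewrite -!mulr_suml -mulrBl mulrC.
have hsum (T' : {set 'I_n}) : \sum_(j in T') h j =
    \sum_(i in S1) \sum_(j in T') W i j - \sum_(i in S2) \sum_(j in T') W i j.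
  by rewrite sumrB/= exchange_big/= [X in _ - X]exchange_big.
have -> : \sum_(i in S) \sum_(j in T) w i * W i j * v j = \sum_(i in S) w i * g i.
  by apply: eq_bigr => i _; rewrite mulr_sumr; apply: eq_bigr => j _; rewrite mulrA.
apply: (le_trans le1); rewrite gh.
apply: (le_trans (ler_wpM2l a0 le2)).
have -> : 4 * a * b * B = a * (b * (4 * B)) by ring.
rewrite ler_wpM2l// ler_wpM2l// !hsum.
have := sub _ _ S1S T1T; have := sub _ _ S1S T2T.
have := sub _ _ S2S T1T; have := sub _ _ S2S T2T.
clear - a; clearbody B.
move: (\sum_(i in S1) \sum_(j in T1) W i j) (\sum_(i in S1) \sum_(j in T2) W i j)
  (\sum_(i in S2) \sum_(j in T1) W i j) (\sum_(i in S2) \sum_(j in T2) W i j).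
move=> c1 c2 c3 c4.
rewrite !ler_norml => /andP[? ?] /andP[? ?] /andP[? ?] /andP[? ?]; lra.
Qed.

Lemma geometric_levels (I : finType) (z : I -> R) (M : R) : 2 <= M ->
  exists (z0 : R) (L : nat) (lev : I -> 'I_L.+1), 0 < z0 /\ forall i, z i != 0 ->
    z0 * M ^+ lev i <= `|z i| < z0 * M ^+ (lev i).+1.
Proof.
move=> M2; have M0 : 0 < M by exact: lt_le_trans M2.
pose z0 : R := \big[Num.min/1]_(i | z i != 0) `|z i|.
have z00 : 0 < z0.
  apply: (big_ind (fun t : R => 0 < t)) => [|x y x0 y0|i zi] //.
    by rewrite lt_min x0 y0.
  by rewrite normr_gt0.
have ex i : exists k, `|z i| < z0 * M ^+ k.+1.
  exists (Num.bound (`|z i| / z0)).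
  rewrite mulrC -ltr_pdivrMr//; apply: (@lt_le_trans _ _ (2 ^+ (Num.bound (`|z i| / z0)))).
    by apply: upper_nthrootP.
  apply: (@le_trans _ _ (M ^+ Num.bound (`|z i| / z0))).
    by rewrite lerXn2r ?nnegrE ?(ltW M0).
  by rewrite ler_weXn2l// ltW// (lt_le_trans _ M2)// ltr1n.
pose k i := ex_minn (ex i); pose L := \max_i k i.
have kL i : (k i < L.+1)%N by rewrite ltnS leq_bigmax.
exists z0, L, (fun i => Ordinal (kL i)); split => // i zi /=.
rewrite /k; case: ex_minnP => m mP mmin; rewrite mP andbT leNgt; apply/negP.
case: m mP mmin => [|m] mP mmin; last by move=> /mmin; rewrite ltnn.
rewrite expr0 mulr1 ltNge => /negP; apply.
by rewrite /z0 (bigD1 i)//= ge_min lexx.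
Qed.

(** Entries of x and y whose magnitudes differ by a factor M are handled by the
    row and column sums. The remaining pairs of entries lie in adjacent
    M-adic levels, where x and y are comparable to multiples of indicators. *)
Lemma bilinear_discrepancy n (W : 'M[R]_n) (alpha d M : R) (x y : 'I_n -> R) :
  2 <= M -> 0 <= alpha -> discrepancy_le W alpha ->
  (forall i, \sum_j `|W i j| <= d) -> (forall j, \sum_i `|W i j| <= d) ->
  `|\sum_i \sum_j x i * W i j * y j| <=
    (6 * alpha * M ^+ 2 + d / M) * (\sum_i x i ^+ 2 + \sum_j y j ^+ 2).
Proof.
move=> M2 al0 disc Wr Wc; have M0 : 0 < M by exact: lt_le_trans M2.
pose z (s : 'I_n + 'I_n) := match s with inl i => x i | inr j => y j end.
have [z0 [L [lev [z00 levP]]]] := geometric_levels z M2.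
pose lx i := lev (inl i); pose ly j := lev (inr j).
pose adj (k l : 'I_L.+1) := (k <= l.+1)%N && (l <= k.+1)%N.
pose F i j := x i * W i j * y j.
pose S k := [set i | (x i != 0) && (lx i == k)].
pose T l := [set j | (y j != 0) && (ly j == l)].
pose a (k : 'I_L.+1) := z0 * M ^+ k.+1.
have a0 k : 0 <= a k by rewrite mulr_ge0 ?exprn_ge0 ?ltW.
have far i j : ~~ adj (lx i) (ly j) ->
    `|F i j| <= (x i ^+ 2 * `|W i j| + y j ^+ 2 * `|W i j|) / M.
  have [x0 _|x0] := eqVneq (x i) 0.
    rewrite /F x0 !mul0r normr0 divr_ge0 ?(ltW M0)// addr_ge0// mulr_ge0 ?sqr_ge0//.
  have [y0 _|y0] := eqVneq (y j) 0.
    rewrite /F y0 !mulr0 normr0 divr_ge0 ?(ltW M0)// addr_ge0// mulr_ge0 ?sqr_ge0//.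
  move=> nadj; rewrite ler_pdivlMr// /F !normrM -mulrDl.
  rewrite (_ : _ * M = M * (`|x i| * `|y j|) * `|W i j|); last by ring.
  rewrite ler_wpM2r// -[x i ^+ 2]real_normK ?num_real// -[y j ^+ 2]real_normK ?num_real//.
  have /andP[lo1 hi1] := levP (inl i) x0; have /andP[lo2 hi2] := levP (inr j) y0.
  have big (p q : nat) : (q.+1 < p)%N -> M * (z0 * M ^+ q.+1) <= z0 * M ^+ p.
    move=> qp; rewrite mulrCA -exprS ler_pM2l// ler_weXn2l//.
    by rewrite (le_trans _ M2)// ler1n.
  move: nadj; rewrite negb_and -!ltnNge => /orP[/big|/big] {}big.
    have xy : M * `|y j| <= `|x i|.
      by rewrite (le_trans _ lo1)// (le_trans _ big)// ler_pM2l// ltW.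
    rewrite mulrCA (le_trans (ler_wpM2l (normr_ge0 _) xy))// -expr2 lerDl.
    by rewrite exprn_ge0.
  have xy : M * `|x i| <= `|y j|.
    by rewrite (le_trans _ lo2)// (le_trans _ big)// ler_pM2l// ltW.
  rewrite mulrA (le_trans (ler_wpM2r (normr_ge0 _) xy))// -expr2 lerDr.
  by rewrite exprn_ge0.
have Fxy i j : (x i == 0) || (y j == 0) -> F i j = 0.
  by move=> /orP[]/eqP e; rewrite /F e ?mulr0 ?mul0r.
have split : \sum_i \sum_j F i j =
    \sum_k \sum_(l | adj k l) \sum_(i in S k) \sum_(j in T l) F i j +
    \sum_i \sum_(j | ~~ adj (lx i) (ly j)) F i j.
  transitivity (\sum_i \sum_(j | adj (lx i) (ly j)) F i j +
                \sum_i \sum_(j | ~~ adj (lx i) (ly j)) F i j).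
    by rewrite -big_split; apply: eq_bigr => i _; rewrite (bigID (fun j => adj (lx i) (ly j))).
  congr (_ + _); rewrite (partition_big lx xpredT)//=; apply: eq_bigr => k _.
  rewrite exchange_big/= (bigID (fun i => x i == 0))/= big1 ?add0r; last first.
    by move=> i /andP[_ xi]; apply: big1 => j _; apply: Fxy; rewrite xi.
  apply: eq_big => [i|i /andP[/eqP -> _]]; first by rewrite inE andbC.
  rewrite (partition_big ly (adj k))//=; apply: eq_bigr => l kl.
  rewrite (bigID (fun j => y j == 0))/= big1 ?add0r; last first.
    by move=> j /andP[_ yj]; apply: Fxy; rewrite yj orbT.
  apply: eq_bigl => j; rewrite inE; case: eqVneq => [->|]; rewrite ?andbF//.
  by rewrite kl andbC.
have lev_mass (w : 'I_n -> R) (lw : 'I_n -> 'I_L.+1) :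
    (forall i, w i != 0 -> z0 * M ^+ lw i <= `|w i|) ->
    \sum_k a k ^+ 2 * #|[set i | (w i != 0) && (lw i == k)]|%:R <=
    M ^+ 2 * \sum_i w i ^+ 2.
  move=> lwP; rewrite (partition_big lw xpredT)//= mulr_sumr; apply: ler_sum => k _.
  rewrite mulr_natr -sumr_const mulr_sumr.
  apply: (@le_trans _ _ (\sum_(i | (w i != 0) && (lw i == k)) M ^+ 2 * w i ^+ 2)).
    rewrite (eq_bigl _ _ (fun i => finset.in_set _ _)); apply: ler_sum => i /andP[wi /eqP lk].
    have -> : a k = M * (z0 * M ^+ lw i) by rewrite /a -lk exprS mulrCA.
    rewrite exprMn ler_wpM2l ?sqr_ge0// -[leRHS]real_normK ?num_real//.
    by rewrite lerXn2r ?nnegrE ?lwP// mulr_ge0 ?exprn_ge0 ?ltW.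
  rewrite [leRHS](bigID (fun i => w i != 0))/= ler_wpDr//.
    by apply: sumr_ge0 => i _; rewrite mulr_ge0 ?sqr_ge0.
  by rewrite (eq_bigl _ _ (fun i => andbC _ _)).
have adj3 k : (#|[pred l | adj k l]| <= 3)%N.
  rewrite cardE -(size_map val); apply: (@uniq_leq_size _ _ [:: k.-1; k : nat; k.+1]).
    by rewrite map_inj_uniq ?enum_uniq//; exact: val_inj.
  move=> m /mapP[l]; rewrite mem_enum !inE => /andP[kl lk] ->.
  move: kl lk => /=; case: (val k) => [|k'] /=; lia.
have adjC k l : adj k l = adj l k by rewrite /adj andbC.
have sum3 (G : 'I_L.+1 -> R) : (forall k, 0 <= G k) ->
    \sum_k \sum_(l | adj k l) G k <= 3 * \sum_k G k.
  move=> G0; rewrite mulr_sumr; apply: ler_sum => k _.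
  by rewrite sumr_const -[leLHS]mulr_natl ler_wpM2r// ler_nat adj3.
have boxes k l : `|\sum_(i in S k) \sum_(j in T l) F i j| <=
    2 * alpha * (a k ^+ 2 * #|S k|%:R + a l ^+ 2 * #|T l|%:R).
  have Sa i : i \in S k -> `|x i| <= a k.
    rewrite inE => /andP[xi /eqP <-].
    by have /andP[_ /ltW] := levP (inl i) xi.
  have Ta j : j \in T l -> `|y j| <= a l.
    rewrite inE => /andP[yj /eqP <-].
    by have /andP[_ /ltW] := levP (inr j) yj.
  apply: (le_trans (discrepancy_box al0 disc (a0 k) (a0 l) Sa Ta)).
  rewrite sqrtrM ?ler0n//; set p := Num.sqrt _; set r := Num.sqrt _.
  have -> : #|S k|%:R = p ^+ 2 by rewrite sqr_sqrtr ?ler0n.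
  have -> : #|T l|%:R = r ^+ 2 by rewrite sqr_sqrtr ?ler0n.
  have := mulr_ge0 al0 (sqr_ge0 (a k * p - a l * r)).
  rewrite -subr_ge0 => h; rewrite -subr_ge0.
  rewrite (_ : _ - _ = 2 * (alpha * (a k * p - a l * r) ^+ 2)); last by ring.
  by rewrite mulr_ge0// -(subr0 (_ * _)).
set X := \sum_i x i ^+ 2; set Y := \sum_j y j ^+ 2.
have near_le : `|\sum_k \sum_(l | adj k l) \sum_(i in S k) \sum_(j in T l) F i j| <=
    6 * alpha * M ^+ 2 * (X + Y).
  rewrite (le_trans (ler_norm_sum _ _ _))//.
  apply: (@le_trans _ _ (\sum_k \sum_(l | adj k l)
      2 * alpha * (a k ^+ 2 * #|S k|%:R + a l ^+ 2 * #|T l|%:R))).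
    apply: ler_sum => k _; rewrite (le_trans (ler_norm_sum _ _ _))//.
    by apply: ler_sum => l _; exact: boxes.
  under eq_bigr do rewrite -mulr_sumr big_split/=.
  rewrite -mulr_sumr big_split/=.
  have sx := sum3 (fun k => a k ^+ 2 * #|S k|%:R)
    (fun k => mulr_ge0 (sqr_ge0 _) (ler0n _ _)).
  have sy := sum3 (fun k => a k ^+ 2 * #|T k|%:R)
    (fun k => mulr_ge0 (sqr_ge0 _) (ler0n _ _)).
  have -> : \sum_k \sum_(l | adj k l) a l ^+ 2 * #|T l|%:R =
            \sum_k \sum_(l | adj k l) a k ^+ 2 * #|T k|%:R.
    rewrite (exchange_big_dep xpredT)//=; apply: eq_bigr => k _.
    by apply: eq_bigl => l; rewrite adjC.
  have mx := lev_mass x lx (fun i xi => proj1 (andP (levP (inl i) xi))).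
  have my := lev_mass y ly (fun i yi => proj1 (andP (levP (inr i) yi))).
  have -> : 6 * alpha * M ^+ 2 * (X + Y) =
    2 * alpha * (3 * (M ^+ 2 * X) + 3 * (M ^+ 2 * Y)) by ring.
  rewrite ler_wpM2l ?mulr_ge0// lerD//.
    by rewrite (le_trans sx)// ler_wpM2l.
  by rewrite (le_trans sy)// ler_wpM2l.
have far_le : `|\sum_i \sum_(j | ~~ adj (lx i) (ly j)) F i j| <= d / M * (X + Y).
  rewrite (le_trans (ler_norm_sum _ _ _))//.
  apply: (@le_trans _ _ (\sum_i \sum_j
      (x i ^+ 2 * `|W i j| + y j ^+ 2 * `|W i j|) / M)).
    apply: ler_sum => i _; rewrite (le_trans (ler_norm_sum _ _ _))//.
    rewrite [leRHS](bigID (fun j => ~~ adj (lx i) (ly j)))/= ler_wpDr//.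
      apply: sumr_ge0 => j _; rewrite divr_ge0 ?(ltW M0)// addr_ge0//.
        by rewrite mulr_ge0 ?sqr_ge0.
      by rewrite mulr_ge0 ?sqr_ge0.
    by apply: ler_sum => j; exact: far.
  under eq_bigr do rewrite -mulr_suml big_split/=.
  rewrite -mulr_suml big_split/= mulrAC ler_pM2r ?invr_gt0// mulrDr lerD//.
    rewrite mulr_sumr; apply: ler_sum => i _.
    by rewrite -mulr_sumr mulrC ler_wpM2r ?sqr_ge0.
  rewrite exchange_big mulr_sumr; apply: ler_sum => j _ /=.
  by rewrite -mulr_sumr mulrC ler_wpM2r ?sqr_ge0.
rewrite -/(F _ _) split (le_trans (ler_normD _ _))// mulrDl.
exact: lerD.
Qed.

(** Testing the bilinear bound on t (W y) and y, with t balancing the two norms. *)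
Lemma opnorm_le_of_bilinear n (W : 'M[R]_n) (h : R) : 0 <= h ->
  (forall x y : 'I_n -> R, `|\sum_i \sum_j x i * W i j * y j| <=
     h * (\sum_i x i ^+ 2 + \sum_j y j ^+ 2)) ->
  opnorm_le W (2 * h).
Proof.
move=> h0 bil m Y.
have col1 (y : 'cV[R]_n) : fnorm (W *m y) <= 2 * h * fnorm y.
  have [->|y0] := eqVneq y 0; first by rewrite mulmx0 fnorm0 mulr0.
  have [->|x0] := eqVneq (W *m y) 0; first by rewrite fnorm0 !mulr_ge0 ?fnorm_ge0.
  set x := W *m y in x0 *.
  have xp := fnorm_gt0 x0; have yp := fnorm_gt0 y0.
  pose t := fnorm y / fnorm x.
  have := bil (fun i => t * x i 0) (fun j => y j 0).
  have cE (v : 'cV[R]_n) : \sum_i v i 0 ^+ 2 = fnorm v ^+ 2.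
    by rewrite sqr_fnorm; apply: eq_bigr => i _; rewrite big_ord1.
  have -> : \sum_i \sum_j t * x i 0 * W i j * y j 0 = t * fnorm x ^+ 2.
    rewrite -cE mulr_sumr; apply: eq_bigr => i _.
    rewrite expr2 mulrA -[RHS]mulrC {3}/x mxE mulr_suml mulrC; apply: eq_bigr => j _.
    by ring.
  have -> : \sum_i (t * x i 0) ^+ 2 = t ^+ 2 * fnorm x ^+ 2.
    by rewrite -cE mulr_sumr; apply: eq_bigr => i _; rewrite exprMn.
  rewrite cE => /(le_trans (ler_norm _)).
  have -> : t * fnorm x ^+ 2 = fnorm y * fnorm x.
    by rewrite /t; field; rewrite lt0r_neq0.
  have -> : t ^+ 2 * fnorm x ^+ 2 = fnorm y ^+ 2.
    by rewrite /t; field; rewrite lt0r_neq0.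
  rewrite (_ : h * _ = fnorm y * (2 * h * fnorm y)); last by ring.
  by rewrite ler_pM2l.
rewrite -ler_sqr ?nnegrE ?mulr_ge0 ?fnorm_ge0// exprMn.
rewrite -(fnorm_trmx (W *m Y)) -(fnorm_trmx Y) !sqr_fnorm_rows mulr_sumr.
apply: ler_sum => j _; rewrite -exprMn lerXn2r ?nnegrE ?mulr_ge0 ?fnorm_ge0//.
rewrite -!tr_col !fnorm_trmx colE -mulmxA -colE; exact: col1.
Qed.

End Discrepancy.

(** * Concentration for products of Bernoulli laws *)

Section BernoulliProduct.
Context {R : realType} (I : finType) (p : I -> R).
Hypothesis p01 : forall e, 0 <= p e <= 1.

Definition coin (e : I) (b : bool) : R := if b then p e else 1 - p e.
Definition bweight (w : {ffun I -> bool}) : R := \prod_e coin e (w e).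
Definition bprob (Q : pred {ffun I -> bool}) : R := \sum_(w | Q w) bweight w.

Lemma coin_ge0 e b : 0 <= coin e b.
Proof. by case: b; have /andP[? ?] := p01 e; rewrite /coin ?subr_ge0. Qed.

Lemma bweight_ge0 w : 0 <= bweight w.
Proof. by apply: prodr_ge0 => e _; exact: coin_ge0. Qed.

Lemma sum_bweight : \sum_w bweight w = 1.
Proof.
rewrite /bweight -(bigA_distr_bigA coin) big1// => e _.
by rewrite big_bool /coin/= addrC subrK.
Qed.

Lemma sub_bprob (Q Q' : pred {ffun I -> bool}) :
  (forall w, Q w -> Q' w) -> bprob Q <= bprob Q'.
Proof.
move=> QQ'; rewrite /bprob [leRHS](bigID Q)/=.
rewrite [X in _ <= X + _](eq_bigl Q) => [|w]; last first.
  by case Qw : (Q w); rewrite ?andbF// QQ'.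
by rewrite lerDl; apply: sumr_ge0 => w _; exact: bweight_ge0.
Qed.

Lemma bprobU (Q Q' : pred {ffun I -> bool}) :
  bprob (predU Q Q') <= bprob Q + bprob Q'.
Proof.
rewrite /bprob (bigID Q)/= lerD//.
  by apply: sub_bprob => w /andP[].
by apply: sub_bprob => w /andP[/orP[->|]].
Qed.

Lemma bprob_exists (J : finType) (A : pred J) (Q : J -> pred {ffun I -> bool}) :
  bprob (fun w => [exists j, A j && Q j w]) <= \sum_(j | A j) bprob (Q j).
Proof.
rewrite /bprob (exchange_big_dep xpredT)//= [leRHS](bigID (fun w => [exists j, A j && Q j w]))/=.
apply: ler_wpDr.
  apply: sumr_ge0 => w _; apply: sumr_ge0 => j _; exact: bweight_ge0.
apply: ler_sum => w /existsP[j jw]; rewrite (bigD1 j)//= lerDl.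
by apply: sumr_ge0 => k _; exact: bweight_ge0.
Qed.

Lemma expR_le_quad (x : R) : x <= 2^-1 -> expR x <= 1 + x + 2 * x ^+ 2.
Proof.
move=> x2; have x1 : 0 < 1 - x by lra.
have e1 : 1 - x <= expR (- x) by exact: expR_ge1Dx.
have : expR x * (1 - x) <= 1.
  by rewrite (le_trans (ler_wpM2l (expR_ge0 x) e1))// -expRD subrr expR0.
rewrite -ler_pdivlMr// => /le_trans; apply.
rewrite ler_pdivrMr//; nra.
Qed.

Lemma coin_mgf e (x : R) : x <= 2^-1 ->
  \sum_b coin e b * expR (x * (b%:R - p e)) <= expR (2 * (p e * x ^+ 2)).
Proof.
move=> x2; have /andP[p0 p1] := p01 e.
rewrite big_bool /coin/= sub0r mulrN mulrBr mulr1 expRD.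
have -> : p e * (expR x * expR (- (x * p e))) + (1 - p e) * expR (- (x * p e)) =
    expR (- (x * p e)) * (1 + p e * (expR x - 1)) by ring.
apply: (@le_trans _ _ (expR (- (x * p e)) * expR (p e * (expR x - 1)))).
  by rewrite ler_wpM2l ?expR_ge0// expR_ge1Dx.
rewrite -expRD ler_expR.
have := ler_wpM2l p0 (expR_le_quad x2).
by move: (expR x) => E; nra.
Qed.

(** The coefficients a w may be random, as long as they are functions of the
    coordinates outside S: conditionally on the latter, the sum over S is a sum
    of independent centered variables with fixed coefficients, and its moment
    generating function is a product. *)
Lemma chernoff (S : {set I}) (a : {ffun I -> bool} -> I -> R) (v t : R) :
  (forall w w' : {ffun I -> bool}, (forall e, e \notin S -> w e = w' e) -> a w = a w') ->
  (forall w e, e \in S -> a w e <= 2^-1) ->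
  (forall w, \sum_(e in S) p e * a w e ^+ 2 <= v) ->
  bprob (fun w => t <= \sum_(e in S) a w e * ((w e)%:R - p e)) <= expR (2 * v - t).
Proof.
move=> aS a2 av; pose Y w := \sum_(e in S) a w e * ((w e)%:R - p e).
pose r (w : {ffun I -> bool}) := [ffun e => (e \notin S) && w e].
have mgf : \sum_w bweight w * expR (Y w) <= expR (2 * v).
  rewrite -[leRHS]mulr1 -[X in _ <= _ * X]sum_bweight mulr_sumr.
  rewrite (partition_big r xpredT)//= [leRHS](partition_big r xpredT)//=.
  apply: ler_sum => h _; rewrite -mulr_sumr.
  have [hS|] := boolP [forall e in S, ~~ h e]; last first.
    rewrite negb_forall => /existsP[e]; rewrite negb_imply negbK => /andP[eS he].
    have r0 : [pred w | r w == h] =1 pred0.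
      move=> w /=; apply/negbTE/eqP => rh.
      by move: he; rewrite -rh ffunE eS.
    rewrite !(big_pred0 _ _ _ _ r0).
    by rewrite mulr0.
  pose Q e (b : bool) := (e \in S) || (b == h e).
  have rQ w : (r w == h) = (w \in family Q).
    apply/eqP/familyP => [rh e|wQ].
      by rewrite unfold_in /Q -rh ffunE; case: (e \in S) => //=.
    apply/ffunP => e; rewrite ffunE.
    have {wQ} : (e \in S) || (w e == h e) := wQ e.
    have := forallP hS e; case: (e \in S) => [/negbTE -> //|_].
    by rewrite orFb => /eqP.
  have aE w : r w == h -> a w = a h.
    move=> /eqP rh; apply: aS => e eS; rewrite -rh ffunE eS//.
  pose G e b := coin e b * (if e \in S then expR (a h e * (b%:R - p e)) else 1).
  have -> : \sum_(w | r w == h) bweight w * expR (Y w) =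
      \prod_e \sum_(b | Q e b) G e b.
    rewrite bigA_distr_big_dep; apply: eq_big => [w|w rw]; first exact: rQ.
    rewrite /Y (aE _ rw) expR_sum/= [X in _ * X]big_mkcond/= -big_split.
    by apply: eq_bigr => e _.
  have -> : \sum_(w | r w == h) bweight w = \prod_e \sum_(b | Q e b) coin e b.
    by rewrite bigA_distr_big_dep; apply: eq_bigl => w; exact: rQ.
  apply: (@le_trans _ _ (\prod_e ((if e \in S then expR (2 * (p e * a h e ^+ 2)) else 1)
      * \sum_(b | Q e b) coin e b))).
    apply: ler_prod => e _; apply/andP; split.
      apply: sumr_ge0 => b _; rewrite mulr_ge0 ?coin_ge0//.
      by case: ifP => // _; exact: expR_ge0.
    rewrite /G /Q; case: ifP => eS /=; last first.
      by rewrite mul1r; apply: ler_sum => b _; rewrite mulr1.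
    rewrite [X in _ <= _ * X]big_bool /coin/= addrC subrK mulr1.
    by apply: coin_mgf; apply: a2.
  rewrite big_split/= ler_wpM2r//.
    by apply: prodr_ge0 => e _; apply: sumr_ge0 => b _; exact: coin_ge0.
  by rewrite -big_mkcond/= -expR_sum ler_expR -mulr_sumr ler_wpM2l.
rewrite expRD (le_trans _ (ler_wpM2r (expR_ge0 _) mgf))// mulr_suml.
rewrite /bprob [leRHS](bigID (fun w => t <= Y w))/= ler_wpDr//.
  by apply: sumr_ge0 => w _; rewrite !mulr_ge0 ?bweight_ge0 ?expR_ge0.
apply: ler_sum => w tY; rewrite -mulrA -expRD ler_peMr ?bweight_ge0//.
by rewrite (le_trans _ (expR_ge1Dx _))// lerDl subr_ge0.
Qed.

End BernoulliProduct.

Local Open Scope classical_set_scope.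
Local Open Scope ring_scope.

(** * K-medians on well separated clusters *)

Section KMedians.
Context {R : realType}.

Lemma enormE k (u : 'rV[R]_k) : enorm u = fnorm u.
Proof. by rewrite /enorm /fnorm big_ord1. Qed.

Lemma has_lbound_enorm n k K (U : 'M[R]_(n, k)) (v : 'I_K -> 'rV[R]_k) i :
  has_lbound (range (fun r => enorm (row i U - v r))).
Proof. by exists 0 => _ [r _ <-]; rewrite enormE fnorm_ge0. Qed.

Lemma inf_enorm_ge0 n k K (U : 'M[R]_(n, k)) (v : 'I_K -> 'rV[R]_k) i :
  (0 < K)%N -> 0 <= inf (range (fun r => enorm (row i U - v r))).
Proof.
move=> K0; apply: lb_le_inf; first by eexists; exists (Ordinal K0).
by move=> _ [r _ <-]; rewrite enormE fnorm_ge0.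
Qed.

(** A center that is far from all the fitted ones would cost a whole block of
    rows, which is more than the cost of the true centers. Every true center
    thus has a fitted one nearby; these are distinct by separation, so they are
    all the fitted centers. *)
Lemma kmedians_exact_recovery n k K (U : 'M[R]_(n, k)) (C v : 'I_K -> 'rV[R]_k)
    (c chat : 'I_n -> 'I_K) (e sep mu : R) :
  (0 < K)%N -> 0 < mu -> 0 <= e ->
  (forall r, mu * n%:R <= (block_size c r)%:R) ->
  (forall i, fnorm (row i U - C (c i)) <= e) ->
  (forall r s, r != s -> sep <= fnorm (C r - C s)) ->
  (1 + mu) * e < mu * (sep / 4) -> e < sep / 4 ->
  kmedians U v ->
  (forall i r, enorm (row i U - v (chat i)) <= enorm (row i U - v r)) ->
  exact_recovery c chat.
Proof.
move=> K0 mu0 e0 blk Ue sepC emu esep vmin chatP.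
have [n0|n0] := posnP n.
  by exists 1%g => i; have := leq_ltn_trans (leq0n i) (ltn_ord i); rewrite lt0n n0.
have near r : exists r', fnorm (v r' - C r) < sep / 4.
  apply: contrapT => /forallNP far.
  have {}far r' : sep / 4 <= fnorm (v r' - C r) by rewrite leNgt; apply/negP/far.
  have := vmin C; rewrite /kmedians_cost ler_pM2l ?invr_gt0 ?ltr0n// => leC.
  have upper : \sum_(i < n) inf (range (fun r => enorm (row i U - C r))) <= n%:R * e.
    rewrite mulr_natl -[X in _ *+ X]card_ord -sumr_const; apply: ler_sum => i _.
    rewrite (le_trans _ (Ue i))// -enormE; apply: ge_inf => //.
    exact: has_lbound_enorm.
  have lower : (sep / 4 - e) *+ block_size c r <=
      \sum_(i < n) inf (range (fun r => enorm (row i U - v r))).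
    rewrite (bigID (fun i => c i == r))/= ler_wpDr//.
      by apply: sumr_ge0 => i _; exact: inf_enorm_ge0.
    rewrite /block_size cardsE -sumr_const; apply: ler_sum => i /eqP/val_inj ci.
    apply: lb_le_inf; first by eexists; exists (Ordinal K0).
    move=> _ [r' _ <-]; rewrite enormE lerBlDr (le_trans (far r'))//.
    rewrite fnormBC (le_trans (fnorm_dist _ (row i U) _))// addrC lerD//.
    by rewrite fnormBC -ci.
  have := le_trans lower (le_trans leC upper).
  rewrite -mulr_natr leNgt => /negP; apply.
  apply: (@lt_le_trans _ _ ((sep / 4 - e) * (mu * n%:R))).
    rewrite mulrA mulrC ltr_pM2r ?ltr0n//; lra.
  by rewrite ler_wpM2l// subr_ge0 ltW.
have [g gP] := choice near.
have gI : injective g.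
  move=> r s grs; apply/eqP/negPn/negP => /sepC; apply/negP; rewrite -ltNge.
  rewrite (le_lt_trans (fnorm_dist _ (v (g r)) _))//.
  have := gP r; have := gP s; rewrite -grs (fnormBC _ (C r)).
  have : 0 < sep / 4 by exact: le_lt_trans esep.
  lra.
exists (perm gI) => i; rewrite permE.
have /codomP[r gr] : chat i \in codom g by exact/inj_card_onto.
rewrite gr; congr (g _); apply/eqP/negPn/negP => rci.
have := chatP i (g (c i)); rewrite gr !enormE; apply/negP; rewrite -ltNge.
have := gP r; have := gP (c i); have := Ue i; have := sepC _ _ rci.
have := fnorm_dist (C r) (v (g r)) (C (c i)).
have := fnorm_dist (v (g r)) (row i U) (C (c i)).
have := fnorm_dist (row i U) (C (c i)) (v (g (c i))).
rewrite (fnormBC (C r) (v (g r))) (fnormBC (v (g r)) (row i U)).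
rewrite (fnormBC (C (c i)) (v (g (c i)))).
lra.
Qed.

End KMedians.

(** * The random graph as a finite product of Bernoulli laws *)

Section RandomGraph.
Context {R : realType} (n K : nat) (c : 'I_n -> 'I_K) (B : 'M[R]_K) (pmax : R).
Hypothesis B01 : forall r s, 0 <= B r s <= 1.
Hypothesis B_max : forall r s, B r s <= pmax.
Hypothesis B_sym : B^T = B.

(** A graph is encoded by the coordinates (i, j) with i < j; the other coordinates
    are set with probability 0. *)
Definition conf := {ffun 'I_n * 'I_n -> bool}.

Definition edge_prob (e : 'I_n * 'I_n) : R :=
  if (e.1 < e.2)%N then B (c e.1) (c e.2) else 0.

Definition conf_edge (w : conf) (i j : 'I_n) : bool :=
  if (i < j)%N then w (i, j) else (j < i)%N && w (j, i).

Definition conf_adj (w : conf) : 'M[R]_n := \matrix_(i, j) (conf_edge w i j)%:R.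

Definition mean_adj : 'M[R]_n := \matrix_(i, j) B (c i) (c j).

Definition noise (w : conf) : 'M[R]_n :=
  \matrix_(i, j) (if i == j then 0 else conf_adj w i j - mean_adj i j).

Lemma edge_prob01 e : 0 <= edge_prob e <= 1.
Proof. by rewrite /edge_prob; case: ifP => _; rewrite ?B01// lexx ler01. Qed.

Lemma conf_edgeC w i j : conf_edge w i j = conf_edge w j i.
Proof. by rewrite /conf_edge; case: ltngtP => //= /val_inj ->; rewrite ltnn. Qed.

Lemma conf_adj_sym w : (conf_adj w)^T = conf_adj w.
Proof. by apply/matrixP => i j; rewrite !mxE conf_edgeC. Qed.

Lemma mean_adj_sym : mean_adj^T = mean_adj.
Proof. by apply/matrixP => i j; rewrite !mxE -{1}B_sym mxE. Qed.

Lemma noise_edge w (i j : 'I_n) : (i < j)%N ->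
  noise w i j = (w (i, j))%:R - edge_prob (i, j).
Proof.
move=> ij; rewrite !mxE /conf_edge /edge_prob/= ij; case: eqVneq => // e.
by move: ij; rewrite e ltnn.
Qed.

Lemma noiseC w i j : noise w i j = noise w j i.
Proof. by rewrite !mxE eq_sym conf_edgeC -{1}B_sym mxE. Qed.

Lemma sum_offdiag (G : 'I_n -> 'I_n -> R) :
  \sum_i \sum_(j | j != i) G i j =
  \sum_(e : 'I_n * 'I_n | (e.1 < e.2)%N) (G e.1 e.2 + G e.2 e.1).
Proof.
rewrite big_split/= -(pair_big_dep xpredT (fun i j : 'I_n => (i < j)%N) G)/=.
rewrite -(pair_big_dep xpredT (fun i j : 'I_n => (i < j)%N) (fun i j => G j i))/=.
rewrite [X in _ + X](exchange_big_dep xpredT)//= -big_split; apply: eq_bigr => i _ /=.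
rewrite (bigID (fun j : 'I_n => (i < j)%N))/=; congr (_ + _); apply: eq_bigl => j.
  by rewrite -(inj_eq val_inj)/=; case: ltngtP.
by rewrite -(inj_eq val_inj)/=; case: ltngtP.
Qed.

Lemma sum_noise w (F : 'I_n -> 'I_n -> R) :
  \sum_i \sum_j F i j * noise w i j =
  \sum_(e : 'I_n * 'I_n | (e.1 < e.2)%N)
    (F e.1 e.2 + F e.2 e.1) * ((w e)%:R - edge_prob e).
Proof.
transitivity (\sum_i \sum_(j | j != i) F i j * noise w i j).
  apply: eq_bigr => i _; rewrite (bigD1 i)//= [noise w i i]mxE eqxx mulr0 add0r//.
rewrite sum_offdiag; apply: eq_bigr => -[i j] /= ij.
by rewrite (noiseC w j i) noise_edge// -mulrDl.
Qed.

Local Notation Pr := (bprob edge_prob).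

(** The noise is symmetric, so an edge carries the two coefficients F i j and F j i,
    and a bilinear form in the noise is a sum over the edges. The one-sided bound
    is applied to the form and to its opposite. *)
Lemma noise_chernoff (S : {set 'I_n * 'I_n}) (F : conf -> 'I_n -> 'I_n -> R)
    (s t : R) :
  (forall w w' : conf, (forall e, e \notin S -> w e = w' e) -> F w = F w') ->
  (forall w (e : 'I_n * 'I_n), (e.1 < e.2)%N -> e \notin S -> F w e.1 e.2 + F w e.2 e.1 = 0) ->
  (forall w (e : 'I_n * 'I_n), (e.1 < e.2)%N -> `|F w e.1 e.2 + F w e.2 e.1| <= 2^-1) ->
  0 <= pmax -> (forall w, \sum_i \sum_j F w i j ^+ 2 <= s) ->
  Pr (fun w => t <= `|\sum_i \sum_j F w i j * noise w i j|) <=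
    2 * expR (4 * pmax * s - t).
Proof.
move=> FS F0 F2 pm0 Fs; pose v := 2 * pmax * s.
have -> : 4 * pmax * s = 2 * v by rewrite /v; ring.
have Fv w : \sum_(e : 'I_n * 'I_n | (e.1 < e.2)%N)
    edge_prob e * (F w e.1 e.2 + F w e.2 e.1) ^+ 2 <= v.
  rewrite /v (mulrC 2) -mulrA; apply: le_trans (ler_wpM2l pm0 (ler_wpM2l _ (Fs w))) => //.
  apply: (@le_trans _ _ (pmax * (2 * \sum_i \sum_(j | j != i) F w i j ^+ 2))).
    rewrite (sum_offdiag (fun i j => F w i j ^+ 2)) !mulr_sumr.
    apply: ler_sum => -[i j] /= _; have /andP[p0 _] := edge_prob01 (i, j).
    apply: ler_pM => //; [exact: sqr_ge0|by rewrite /edge_prob; case: ifP|].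
    by have := sqr_ge0 (F w i j - F w j i); lra.
  rewrite ler_wpM2l// ler_wpM2l//; apply: ler_sum => i _.
  by rewrite [leRHS](bigD1 i)//= lerDr sqr_ge0.
pose S' := [set e : 'I_n * 'I_n in S | (e.1 < e.2)%N].
have sumS (G : 'I_n * 'I_n -> R) :
    (forall e : 'I_n * 'I_n, (e.1 < e.2)%N -> e \notin S -> G e = 0) ->
    \sum_(e : 'I_n * 'I_n | (e.1 < e.2)%N) G e = \sum_(e in S') G e.
  move=> G0; rewrite (bigID (mem S))/= [X in _ + X]big1 ?addr0; last first.
    by move=> e /andP[? ?]; exact: G0.
  by apply: eq_bigl => e; rewrite inE andbC.
pose a (z : bool) w (e : 'I_n * 'I_n) : R := if e \in S' then
  (-1) ^+ z * (F w e.1 e.2 + F w e.2 e.1) else 0.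
have one (z : bool) : Pr (fun w => t <= (-1) ^+ z * \sum_i \sum_j F w i j * noise w i j) <=
    expR (2 * v - t).
  apply: (@le_trans _ _ (Pr (fun w =>
    t <= \sum_(e in S') a z w e * ((w e)%:R - edge_prob e)))).
    apply: sub_bprob => [|w]; first exact: edge_prob01.
    rewrite sum_noise mulr_sumr sumS; last first.
      by move=> e elt eS; rewrite F0// mul0r mulr0.
    rewrite (eq_bigr (fun e => a z w e * ((w e)%:R - edge_prob e)))//.
    by move=> e eS; rewrite /a eS mulrA.
  apply: chernoff => [|w w' ww'|w e _|w]; first exact: edge_prob01.
  - have Fw : F w = F w'.
      by apply: FS => e eS; apply: ww'; rewrite inE (negbTE eS).
    by apply/funext => e; rewrite /a Fw.
  - rewrite /a; case: ifP => eS; last by rewrite invr_ge0.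
    move: eS; rewrite inE => /andP[_ /F2 {}F2].
    by rewrite (le_trans (ler_norm _))// normrM normrX normrN1 expr1n mul1r.
  - apply: le_trans (Fv w); rewrite sumS; last first.
      by move=> e elt eS; rewrite F0// expr0n mulr0.
    apply: ler_sum => e eS; rewrite /a eS exprMn -exprM mulnC exprM sqrrN.
    by rewrite !expr1n mul1r.
apply: (@le_trans _ _ (Pr (predU
   (fun w => t <= (-1) ^+ false * \sum_i \sum_j F w i j * noise w i j)
   (fun w => t <= (-1) ^+ true * \sum_i \sum_j F w i j * noise w i j)))).
  apply: sub_bprob => [|w]; first exact: edge_prob01.
  by rewrite /= expr0 expr1 mul1r mulN1r ler_normr.
rewrite (le_trans (bprobU _ _ _))//; first exact: edge_prob01.
by rewrite mulr_natl mulr2n lerD.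
Qed.

Definition agree_off (i : 'I_n) (w w' : conf) : Prop :=
  forall e, e.1 != i -> e.2 != i -> w e = w' e.

(** Row i of the noise is independent of everything that does not read the edges
    at i. *)
Lemma noise_row_chernoff (i : 'I_n) (y : conf -> 'I_n -> R) (s t : R) :
  (forall w w', agree_off i w w' -> y w = y w') ->
  (forall w j, `|y w j| <= 2^-1) -> (forall w, \sum_j y w j ^+ 2 <= s) ->
  0 <= pmax ->
  Pr (fun w => t <= `|\sum_j noise w i j * y w j|) <= 2 * expR (4 * pmax * s - t).
Proof.
move=> yS y2 ys pm0; pose F w (a b : 'I_n) : R := (a == i)%:R * y w b.
pose S := [set e : 'I_n * 'I_n | (e.1 == i) || (e.2 == i)]%SET.
have FE w (H : 'I_n -> 'I_n -> R -> R) : (forall a b, H a b 0 = 0) ->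
    \sum_a \sum_b H a b (F w a b) = \sum_b H i b (y w b).
  move=> H0; rewrite (bigD1 i)//= [X in _ + X]big1 ?addr0.
    by apply: eq_bigr => j _; rewrite /F eqxx mul1r.
  by move=> a /negbTE ai; apply: big1 => b _; rewrite /F ai mul0r.
apply: (@le_trans _ _ (Pr (fun w => t <= `|\sum_a \sum_b F w a b * noise w a b|))).
  apply: sub_bprob => [|w]; first exact: edge_prob01.
  rewrite (FE w (fun a b x => x * noise w a b)) => [|a b]; last by rewrite mul0r.
  by under [X in _ -> _ <= `|X|]eq_bigr do rewrite mulrC.
apply: (noise_chernoff (S := S) (F := F)) => //.
- move=> w w' ww'; rewrite /F; suff -> : y w = y w' by [].
  by apply: yS => e e1 e2; apply: ww'; rewrite inE negb_or e1.
- move=> w e _; rewrite inE negb_or /F => /andP[/negbTE -> /negbTE ->].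
  by rewrite !mul0r addr0.
- move=> w e elt; rewrite /F; have [e1|_] := eqVneq e.1 i.
    have [e2|_] := eqVneq e.2 i; first by move: elt; rewrite e1 e2 ltnn.
    by rewrite mul1r mul0r addr0.
  rewrite mul0r add0r normrM (le_trans _ (y2 w e.1))//.
  by case: eqP => _; rewrite ?normr1 ?mul1r// normr0 mul0r.
- by move=> w; rewrite (FE w (fun a b x => x ^+ 2)) => [|a b]; rewrite ?expr0n.
Qed.

Context (b N : R).
Hypothesis b_ge1 : 1 <= b.
Hypothesis N_gt0 : 0 < N.
Hypothesis pmaxE : n%:R * pmax = b * N.
Hypothesis pmax0 : 0 <= pmax.

Let b_gt0 : 0 < b. Proof. exact: lt_le_trans b_ge1. Qed.

(** Row sums of the noise: the Chernoff bound with coefficients 1/2. *)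
Lemma degree_tail i :
  Pr (fun w => 2 * (b + 1) * N <= `|\sum_j noise w i j|) <= 2 * expR (- N).
Proof.
have -> : - N = 4 * pmax * (n%:R / 4) - (b + 1) * N.
  have -> : 4 * pmax * (n%:R / 4) = b * N by rewrite -pmaxE; field.
  by ring.
apply: le_trans (noise_row_chernoff (y := fun _ _ => 2^-1) (i := i) _ _ _ _ _) => //.
- apply: sub_bprob => [|w]; first exact: edge_prob01.
  rewrite -mulr_suml normrM (ger0_norm (_ : 0 <= 2^-1 :> R)) ?invr_ge0// => h.
  lra.
- by move=> _ j; rewrite ger0_norm.
- by move=> _; rewrite sumr_const card_ord -[leLHS]mulr_natr; lra.
Qed.

(** The variance term is of order g^2 pmax |S| |T|. As sqrt (|S| |T|) <= n, it is at
    most a multiple of g^2 N sqrt (|S| |T|), so a coefficient g of order delta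
    makes the linear term win for all sizes at once. *)
Lemma discrepancy_tail (S T : {set 'I_n}) (delta : R) : 0 < delta -> delta <= 2 * b ->
  Pr (fun w => delta * N * Num.sqrt (#|S|%:R * #|T|%:R) <=
        `|\sum_(i in S) \sum_(j in T) noise w i j|) <=
  2 * expR (- (delta ^+ 2 / (16 * b) * N * Num.sqrt (#|S|%:R * #|T|%:R))).
Proof.
move=> d0 db; set r := Num.sqrt _; pose g := delta / (8 * b).
have g0 : 0 < g by rewrite divr_gt0// mulr_gt0.
have r0 : 0 <= r by exact: sqrtr_ge0.
have r2 : r ^+ 2 = #|S|%:R * #|T|%:R by rewrite sqr_sqrtr// mulr_ge0.
have rn : r <= n%:R.
  rewrite -ler_sqr ?nnegrE// r2 expr2 ler_pM// ler_nat -[X in (_ <= X)%N]card_ord.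
    exact: max_card.
  exact: max_card.
pose F (w : conf) i j : R := g * ((i \in S) && (j \in T))%:R.
have FE (H : 'I_n -> 'I_n -> R -> R) : (forall i j, H i j 0 = 0) ->
    \sum_i \sum_j H i j (F [ffun=> false] i j) = \sum_(i in S) \sum_(j in T) H i j g.
  move=> H0; rewrite [RHS]big_mkcond; apply: eq_bigr => i _; rewrite /F.
  case: (i \in S) => /=; last by apply: big1 => j _; rewrite mulr0.
  rewrite [RHS]big_mkcond; apply: eq_bigr => j _.
  by case: (j \in T) => /=; rewrite ?mulr1 ?mulr0.
have Fs w : \sum_i \sum_j F w i j ^+ 2 <= g ^+ 2 * r ^+ 2.
  rewrite (FE (fun _ _ x => x ^+ 2)) => [|i j]; last by rewrite expr0n.
  rewrite sumr_const sumr_const -mulrnA mulnC r2 -natrM mulr_natr//.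
apply: (@le_trans _ _ (Pr (fun w => g * (delta * N * r) <=
    `|\sum_i \sum_j F w i j * noise w i j|))).
  apply: sub_bprob => [|w]; first exact: edge_prob01.
  rewrite (FE (fun i j x => x * noise w i j)) => [|i j]; last by rewrite mul0r.
  under [X in _ -> _ <= `|X|]eq_bigr do rewrite -mulr_sumr.
  by rewrite -mulr_sumr normrM (gtr0_norm g0) ler_pM2l.
apply: (@le_trans _ _ (2 * expR (4 * pmax * (g ^+ 2 * r ^+ 2) - g * (delta * N * r)))).
  apply: (noise_chernoff (S := [set: _]%SET) (F := F)) => //.
    by move=> w e _; rewrite inE.
  move=> w e _; rewrite /F -mulrDr normrM (gtr0_norm g0).
  apply: (@le_trans _ _ (g * 2)).
    rewrite ler_pM2l// ger0_norm ?addr_ge0// -natrD ler_nat.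
    by case: (_ && _); case: (_ && _).
  by rewrite /g -ler_pdivlMr// ler_pdivrMr ?mulr_gt0//; lra.
rewrite ler_pM2l// ler_expR.
have le1 : 4 * pmax * (g ^+ 2 * r ^+ 2) <= 4 * g ^+ 2 * (b * N) * r.
  rewrite -pmaxE (_ : 4 * pmax * _ = 4 * g ^+ 2 * pmax * r * r); last by ring.
  rewrite (_ : _ * (n%:R * pmax) * r = 4 * g ^+ 2 * pmax * r * n%:R); last by ring.
  by rewrite ler_wpM2l// (mulr_ge0 (mulr_ge0 (mulr_ge0 (ler0n _ 4) (sqr_ge0 g)) pmax0) r0).
apply: (@le_trans _ _ (4 * g ^+ 2 * (b * N) * r - g * (delta * N * r))).
  by rewrite lerB.
rewrite le_eqVlt; apply/orP; left; apply/eqP; rewrite /g.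
by field; rewrite lt0r_neq0.
Qed.

Definition max_row k (X : 'M[R]_(n, k)) : R := \big[Order.max/0]_j fnorm (row j X).

Lemma max_row_le k (X : 'M[R]_(n, k)) j : fnorm (row j X) <= max_row X.
Proof. exact: le_bigmax. Qed.

Lemma max_row_lub k (X : 'M[R]_(n, k)) m :
  0 <= m -> (forall j, fnorm (row j X) <= m) -> max_row X <= m.
Proof. by move=> m0 Xm; apply: bigmax_le => // j _; exact: Xm. Qed.

Lemma max_row_ge0 k (X : 'M[R]_(n, k)) : 0 <= max_row X.
Proof.
by apply: (big_ind (fun t : R => 0 <= t)) => [|x y x0 _|j _];
  rewrite ?le_max ?x0 ?fnorm_ge0.
Qed.

(** The column is rescaled by n^(-1/2) plus the largest row of X: the second part
    keeps the coefficients bounded, the first one keeps the sum of their squares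
    below n. *)
Lemma leave_one_out_tail k (i : 'I_n) (r : 'I_k) (X : conf -> 'M[R]_(n, k)) (eps : R) :
  (forall w w', agree_off i w w' -> X w = X w') ->
  (forall w, \sum_j X w j r ^+ 2 <= 1) -> 0 < eps -> eps <= 4 * b ->
  Pr (fun w => eps * N * ((Num.sqrt n%:R)^-1 + max_row (X w)) <=
        `|\sum_j noise w i j * X w j r|) <=
  2 * expR (- (eps ^+ 2 / (16 * b) * N)).
Proof.
move=> XS X1 e0 eb; set s := (Num.sqrt _)^-1.
have n0 : 0 < n%:R :> R.
  by rewrite ltr0n; exact: leq_ltn_trans (leq0n i) (ltn_ord i).
have s0 : 0 < s by rewrite invr_gt0 sqrtr_gt0.
pose sm w := s + max_row (X w).
have sm0 w : 0 < sm w by rewrite ltr_pwDl// max_row_ge0.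
pose g := eps / (8 * b).
have g0 : 0 < g by rewrite divr_gt0// mulr_gt0.
pose y w j := g / sm w * X w j r.
have gs w : 0 < g / sm w by rewrite divr_gt0.
have -> : - (eps ^+ 2 / (16 * b) * N) = 4 * pmax * (g ^+ 2 * n%:R) - g * (eps * N).
  rewrite (_ : 4 * pmax * (g ^+ 2 * n%:R) = 4 * g ^+ 2 * (n%:R * pmax)); last by ring.
  by rewrite pmaxE /g; field; rewrite lt0r_neq0.
apply: le_trans (noise_row_chernoff (y := y) (i := i) _ _ _ _ _) => //.
- apply: sub_bprob => [|w]; first exact: edge_prob01.
  rewrite /y; under [X in _ -> _ <= `|X|]eq_bigr do rewrite mulrCA.
  rewrite -mulr_sumr normrM (gtr0_norm (gs w)) => h.
  by rewrite [leRHS]mulrAC ler_pdivlMr// -mulrA ler_pM2l.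
- by move=> w w' /XS ww'; rewrite /y /sm ww'.
- move=> w j; rewrite /y normrM (gtr0_norm (gs w)) mulrAC ler_pdivrMr//.
  apply: ler_pM; rewrite ?(ltW g0)//.
    by rewrite /g ler_pdivrMr ?mulr_gt0//; lra.
  rewrite (le_trans (normr_entry_le _ _ _))// (le_trans (max_row_le _ _))//.
  by rewrite lerDr ltW.
- move=> w; rewrite /y; under eq_bigr do rewrite exprMn.
  rewrite -mulr_sumr -[leRHS]mulr1 ler_pM ?sqr_ge0//.
    by apply: sumr_ge0 => j _; exact: sqr_ge0.
  rewrite exprMn ler_wpM2l ?sqr_ge0// -[n%:R]sqr_sqrtr ?(ltW n0)//.
  rewrite lerXn2r ?nnegrE ?invr_ge0 ?sqrtr_ge0 ?(ltW (sm0 w))//.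
  by rewrite -[leRHS]invrK lef_pV2 ?posrE ?sm0 ?s0// lerDl max_row_ge0.
Qed.

End RandomGraph.

(** * Recovery from row bounds *)

Section BlockMean.
Context {R : realType} (n K : nat) (c : 'I_n -> 'I_K) (B : 'M[R]_K) (mu : R).
Hypothesis mu_gt0 : 0 < mu.
Hypothesis block_ge : forall r, mu * n%:R <= (block_size c r)%:R.
Hypothesis n_gt0 : (0 < n)%N.
Hypothesis B_sym : B^T = B.
Hypothesis B_unit : B \in unitmx.

Local Notation P := (mean_adj c B).

Definition membership : 'M[R]_(n, K) := \matrix_(i, r) (c i == r)%:R.
Local Notation Z := membership.

Definition sizes : 'rV[R]_K := \row_r (block_size c r)%:R.
Definition inv_sizes : 'rV[R]_K := \row_r (block_size c r)%:R^-1.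

Lemma block_size_gt0 r : 0 < (block_size c r)%:R :> R.
Proof. by apply: lt_le_trans (block_ge r); rewrite mulr_gt0// ltr0n. Qed.

Lemma membership_mul m (Y : 'M[R]_(K, m)) i j : (Z *m Y) i j = Y (c i) j.
Proof.
rewrite mxE (bigD1 (c i))//= mxE eqxx mul1r big1 ?addr0// => r.
by rewrite mxE eq_sym => /negbTE ->; rewrite mul0r.
Qed.

Lemma row_membership_mul m (Y : 'M[R]_(K, m)) i : row i (Z *m Y) = row (c i) Y.
Proof. by apply/rowP => j; rewrite mxE membership_mul mxE. Qed.

Lemma mean_adjE : P = Z *m B *m Z^T.
Proof.
apply/matrixP => i j; rewrite -mulmxA membership_mul.
have -> : B *m Z^T = (Z *m B)^T by rewrite trmx_mul B_sym.
by rewrite [RHS]mxE membership_mul mxE -{1}B_sym mxE.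
Qed.

Lemma tr_membership_mul : Z^T *m Z = diag_mx sizes.
Proof.
apply/matrixP => r s; rewrite !mxE.
rewrite (eq_bigr (fun i => (c i == r)%:R * (c i == s)%:R)); last first.
  by move=> i _; rewrite !mxE.
rewrite /block_size -sum1_card natr_sum.
have [<-|rs] := eqVneq r s.
  rewrite mulr1n [RHS]big_mkcond; apply: eq_bigr => i _; rewrite inE.
  by case: (c i == r); rewrite ?mulr1 ?mulr0.
rewrite mulr0n big1// => i _; have [->|] := eqVneq (c i) r; last by rewrite mul0r.
by rewrite (negbTE rs) mulr0.
Qed.

Lemma sizesV : diag_mx sizes *m diag_mx inv_sizes = 1%:M.
Proof.
rewrite mulmx_diag; apply/matrixP => r s; rewrite !mxE mulfV//.
by rewrite lt0r_neq0// block_size_gt0.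
Qed.

Lemma sizesVl : diag_mx inv_sizes *m diag_mx sizes = 1%:M.
Proof. exact: mulmx1C sizesV. Qed.

Lemma membership_inj (y : 'cV[R]_K) : Z *m y = 0 -> y = 0.
Proof.
move=> Zy; have : diag_mx inv_sizes *m (Z^T *m (Z *m y)) = 0.
  by rewrite Zy !mulmx0.
by rewrite (mulmxA Z^T) tr_membership_mul mulmxA sizesVl mul1mx.
Qed.

(** Pseudo-inverse of the mean: it inverts P on the block-constant vectors. *)
Definition mean_pinv : 'M[R]_n :=
  Z *m (diag_mx inv_sizes *m invmx B *m diag_mx inv_sizes) *m Z^T.

Lemma mean_pinvK : P *m (mean_pinv *m Z) = Z.
Proof.
rewrite mean_adjE /mean_pinv -!mulmxA tr_membership_mul sizesVl mulmx1.
rewrite (mulmxA Z^T Z) tr_membership_mul (mulmxA (diag_mx sizes)) sizesV mul1mx.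
by rewrite mulmxV// mulmx1.
Qed.

Lemma mean_pinv_mulK : mean_pinv *m (P *m Z) = Z.
Proof.
rewrite mean_adjE /mean_pinv -!mulmxA tr_membership_mul.
rewrite (mulmxA Z^T Z) tr_membership_mul (mulmxA (diag_mx inv_sizes) (diag_mx sizes)).
by rewrite sizesVl mul1mx mulKmx// sizesVl mulmx1.
Qed.

Lemma fnorm_mean_pinv : fnorm mean_pinv <= fnorm (invmx B) * K%:R / (mu * n%:R).
Proof.
pose Y := Z *m diag_mx inv_sizes.
have -> : mean_pinv = Y *m invmx B *m Y^T.
  by rewrite /mean_pinv /Y trmx_mul tr_diag_mx !mulmxA.
have Y2 : fnorm Y ^+ 2 <= K%:R / (mu * n%:R).
  have -> : fnorm Y ^+ 2 = \sum_r (block_size c r)%:R^-1.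
    rewrite sqr_fnorm_tr /Y trmx_mul tr_diag_mx -mulmxA (mulmxA Z^T).
    rewrite tr_membership_mul sizesV mulmx1 mxtrace_diag.
    by apply: eq_bigr => r _; rewrite mxE.
  rewrite -[X in X%:R / _]card_ord mulr_natl -sumr_const; apply: ler_sum => r _.
  by rewrite lef_pV2 ?posrE ?block_size_gt0// mulr_gt0// ltr0n.
rewrite (le_trans (fnormM _ _))// fnorm_trmx.
rewrite (le_trans (ler_wpM2r (fnorm_ge0 _) (fnormM _ _)))//.
rewrite (mulrC (fnorm Y)) -[leLHS]mulrA -expr2 -[leRHS]mulrA ler_wpM2l ?fnorm_ge0//.
Qed.

Lemma mean_adj_ge (g : R) (y : 'cV[R]_K) : 0 <= g -> g * fnorm mean_pinv <= 1 ->
  g * fnorm (Z *m y) <= fnorm (P *m (Z *m y)).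
Proof.
move=> g0 gQ; have := fnormM mean_pinv (P *m (Z *m y)).
have -> : mean_pinv *m (P *m (Z *m y)) = Z *m y.
  by rewrite (mulmxA P) mulmxA mean_pinv_mulK.
move=> /(ler_wpM2l g0) /le_trans; apply.
by rewrite mulrA ler_piMl ?fnorm_ge0.
Qed.

(** The indicator of block r divided by its size, minus the same for block s. *)
Definition contrast (r s : 'I_K) : 'cV[R]_n :=
  Z *m (diag_mx inv_sizes *m (delta_mx r 0 - delta_mx s 0)).

Lemma contrast_mul r s m (Y : 'M[R]_(K, m)) :
  (contrast r s)^T *m (Z *m Y) = row r Y - row s Y.
Proof.
rewrite /contrast !trmx_mul tr_diag_mx -!mulmxA (mulmxA Z^T Z) tr_membership_mul.
rewrite (mulmxA (diag_mx inv_sizes)) sizesVl mul1mx linearB/= mulmxBl.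
by rewrite !trmx_delta -!rowE.
Qed.

(** The contrast has inner product 1 with the indicator of block r, whose norm is at
    most the square root of n. *)
Lemma fnorm_contrast r s : r != s -> (Num.sqrt n%:R)^-1 <= fnorm (contrast r s).
Proof.
move=> rs; have Zw : row r Z^T *m contrast r s = 1%:M.
  rewrite -row_mul /contrast (mulmxA Z^T) tr_membership_mul mulmxA sizesV mul1mx.
  apply/matrixP => i j; rewrite !ord1 !mxE !eqxx (negbTE rs) subr0//.
have := fnormM (row r Z^T) (contrast r s); rewrite Zw.
have -> : fnorm (1%:M : 'M[R]_1) = 1.
  by rewrite /fnorm !big_ord1 !mxE expr1n sqrtr1.
have Zr : fnorm (row r Z^T) <= Num.sqrt n%:R.
  rewrite -ler_sqr ?nnegrE ?fnorm_ge0 ?sqrtr_ge0// (sqr_sqrtr (ler0n R n)) sqr_fnorm.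
  rewrite big_ord1 -[X in _ <= X%:R]card_ord -sum1_card natr_sum.
  apply: ler_sum => i _; rewrite !mxE -natrX ler_nat.
  by case: eqP.
move=> /le_trans /(_ (ler_wpM2r (fnorm_ge0 _) Zr)).
by rewrite -ler_pdivrMl ?mulr1// sqrtr_gt0 ltr0n.
Qed.

(** The row of U at i is close to the center attached to the block of i, because
    P U diag l ^-1 is constant on blocks; the centers are well separated. *)
Lemma recovery_of_row_bounds (A : 'M[R]_n) (U : 'M[R]_(n, K)) (l : 'rV[R]_K)
    (lo hi e : R) (v : 'I_K -> 'rV[R]_K) (chat : 'I_n -> 'I_K) :
  (0 < K)%N -> mu <= 1 ->
  A^T = A -> spectral_split A U l lo hi -> opnorm_le (A - P) hi ->
  0 <= hi -> 0 < lo -> 8 * hi * fnorm mean_pinv <= 1 -> 4 * hi <= lo ->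
  0 <= e -> (forall i, fnorm (row i ((A - P) *m U)) <= lo * e) ->
  16 * e < mu * (Num.sqrt n%:R)^-1 ->
  kmedians U v ->
  (forall i r, enorm (row i U - v (chat i)) <= enorm (row i U - v r)) ->
  exact_recovery c chat.
Proof.
move=> K0 mu1 As sU Wh hi0 lo0 hQ hlo e0 WU es km chatP.
have [U1 AU ll _] := sU; set s := (Num.sqrt _)^-1 in es.
pose li : 'rV[R]_K := \row_k (l 0 k)^-1.
have l0 k : l 0 k != 0 by rewrite -normr_gt0; exact: lt_le_trans (ll k).
have lil : diag_mx li *m diag_mx l = 1%:M.
  by rewrite mulmx_diag; apply/matrixP => i j; rewrite !mxE mulVf.
pose Cm := B *m Z^T *m U *m diag_mx li.
have CE : Z *m Cm *m diag_mx l = P *m U.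
  by rewrite /Cm mean_adjE -!mulmxA lil mulmx1.
have UC : (U - Z *m Cm) *m diag_mx l = (A - P) *m U.
  by rewrite !mulmxBl CE AU.
have Ue i : fnorm (row i U - row (c i) Cm) <= e.
  rewrite -row_membership_mul -linearB/= -(ler_pM2l lo0).
  apply: le_trans (WU i); rewrite -UC row_mul.
  rewrite -(fnorm_trmx (_ *m diag_mx l)) -(fnorm_trmx (row _ _)) trmx_mul tr_diag_mx.
  by apply: fnorm_diag_ge; [exact: ltW|move=> ? ? _; exact: ll].
have sep r t : r != t -> s / 2 <= fnorm (row r Cm - row t Cm).
  move=> rt; have PQ : P *m (mean_pinv *m contrast r t) = contrast r t.
    by rewrite /contrast (mulmxA mean_pinv) mulmxA mean_pinvK.
  have := center_separation As (mean_adj_sym c B_sym) sU Wh hi0 lo0 PQ hQ hlo CE.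
  rewrite contrast_mul => /(le_trans (fnorm_contrast rt)); rewrite -/s; lra.
apply: (kmedians_exact_recovery K0 mu_gt0 e0 block_ge Ue sep _ _ km chatP).
  have := ler_wpM2r e0 mu1; lra.
have s0 : 0 <= s by rewrite invr_ge0 sqrtr_ge0.
have := ler_wpM2r s0 mu1; lra.
Qed.

End BlockMean.

(** * Good configurations *)

Section GoodConfigurations.
Context {R : realType} (n K : nat) (c : 'I_n -> 'I_K) (B : 'M[R]_K) (pmax : R).
Hypothesis B01 : forall r s, 0 <= B r s <= 1.
Hypothesis B_max : forall r s, B r s <= pmax.
Hypothesis B_sym : B^T = B.
Context (b N : R).
Hypothesis b_ge1 : 1 <= b.
Hypothesis N_gt0 : 0 < N.
Hypothesis pmaxE : n%:R * pmax = b * N.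
Hypothesis pmax0 : 0 <= pmax.
Hypothesis n_gt0 : (0 < n)%N.

Local Notation conf := (conf n).
Local Notation P := (mean_adj c B).
Local Notation W := (noise c B).
Local Notation A := (@conf_adj R n).

Definition degrees_ok (w : conf) : bool :=
  [forall i, `|\sum_j W w i j| < 2 * (b + 1) * N].

(** Pairs of sets of very different sizes are left out: the union bound would
    fail for them, and the degrees suffice. *)
Definition comparable_sets (theta : R) (S T : {set 'I_n}) : bool :=
  [&& (0 < #|S|)%N, (0 < #|T|)%N, theta ^+ 2 * #|T|%:R <= #|S|%:R
    & theta ^+ 2 * #|S|%:R <= #|T|%:R :> R].

Definition discrepancy_ok (delta theta : R) (w : conf) : bool :=
  [forall S : {set 'I_n}, forall T : {set 'I_n}, comparable_sets theta S T ==>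
    (`|\sum_(i in S) \sum_(j in T) W w i j| <
     delta * N * Num.sqrt (#|S|%:R * #|T|%:R))].

Definition tame (delta theta : R) (w : conf) : bool :=
  degrees_ok w && discrepancy_ok delta theta w.

Definition degree_bound : R := 4 * b + 2.
Local Notation d := degree_bound.

Lemma sum_mean i : \sum_j P i j <= b * N.
Proof.
rewrite -pmaxE mulr_natl -[X in _ <= _ *+ X]card_ord -sumr_const.
by apply: ler_sum => j _; rewrite mxE.
Qed.

Lemma conf_adj_ge0 w i j : 0 <= A w i j.
Proof. by rewrite mxE. Qed.

Lemma mean_ge0 i j : 0 <= P i j.
Proof. by rewrite mxE; have /andP[] := B01 (c i) (c j). Qed.

Lemma degree_le w i : degrees_ok w -> \sum_j A w i j <= d * N.
Proof.
move=> /forallP /(_ i) Wi.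
have le1 : \sum_j A w i j <= \sum_j W w i j + \sum_j P i j.
  rewrite -big_split; apply: ler_sum => j _ /=; rewrite [W w i j]mxE.
  case: eqVneq => [<-|_]; last by rewrite subrK.
  by rewrite add0r mxE /conf_edge ltnn mean_ge0.
have := sum_mean i; have := ler_norm (\sum_j W w i j).
rewrite /degree_bound; have := ltW N_gt0; have := b_ge1; nra.
Qed.

Lemma noise_row_le w i : degrees_ok w -> \sum_j `|W w i j| <= d * N.
Proof.
move=> /forallP /(_ i) Wi.
have le1 : \sum_j `|W w i j| <= \sum_j W w i j + 2 * \sum_j P i j.
  rewrite mulr_sumr -big_split; apply: ler_sum => j _ /=; rewrite [W w i j]mxE.
  have p0 := mean_ge0 i j; have a0 := conf_adj_ge0 w i j.
  case: eqVneq => [_|_]; first by rewrite normr0 add0r mulr_ge0.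
  rewrite ler_norml; apply/andP; split; lra.
have := sum_mean i; have := ler_norm (\sum_j W w i j).
rewrite /degree_bound; have := ltW N_gt0; have := b_ge1; nra.
Qed.

Lemma degree_bound_gt0 : 0 < d.
Proof. by rewrite /degree_bound; have := b_ge1; lra. Qed.

Lemma tame_discrepancy (delta theta : R) w :
  0 < delta -> theta = delta / d -> tame delta theta w ->
  discrepancy_le (W w) (delta * N).
Proof.
move=> d0 thE /andP[deg disc]; have dd := degree_bound_gt0.
have th0 : 0 < theta by rewrite thE divr_gt0.
(* the smaller set meets at most its own size times the maximal degree *)
have small (S T : {set 'I_n}) : #|S|%:R <= theta ^+ 2 * #|T|%:R ->
    `|\sum_(i in S) \sum_(j in T) W w i j| <=
    delta * N * Num.sqrt (#|S|%:R * #|T|%:R).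
  move=> ST; rewrite (le_trans (ler_norm_sum _ _ _))//.
  apply: (@le_trans _ _ (\sum_(i in S) d * N)).
    apply: ler_sum => i _; rewrite (le_trans (ler_norm_sum _ _ _))//.
    rewrite (le_trans _ (noise_row_le i deg))// [leRHS](bigID (mem T))/= lerDl.
    by apply: sumr_ge0 => j _.
  rewrite sumr_const -[leLHS]mulr_natr.
  have -> : delta = theta * d by rewrite thE divfK// lt0r_neq0.
  set r := Num.sqrt _; have -> : theta * d * N * r = d * N * (theta * r) by ring.
  rewrite ler_wpM2l ?mulr_ge0 ?(ltW dd) ?(ltW N_gt0)// /r.
  rewrite -ler_sqr ?nnegrE ?mulr_ge0 ?sqrtr_ge0 ?(ltW th0)// exprMn.
  rewrite sqr_sqrtr ?mulr_ge0// mulrCA expr2 ler_wpM2l//.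

move=> S T; have [S0|S0] := posnP #|S|.
  rewrite (cards0_eq S0) big_set0 normr0 mulr_ge0 ?sqrtr_ge0// mulr_ge0 ?ltW//.
have [T0|T0] := posnP #|T|.
  rewrite (cards0_eq T0) big1 ?normr0 => [|i _]; last by rewrite big_set0.
  by rewrite mulr_ge0 ?sqrtr_ge0// mulr_ge0 ?ltW.
have [/small//|ST] := leP (#|S|%:R : R) (theta ^+ 2 * #|T|%:R).
have [/small|TS] := leP (#|T|%:R : R) (theta ^+ 2 * #|S|%:R).
  rewrite mulrC exchange_big/=; under eq_bigr do under eq_bigr do rewrite noiseC//.
  by rewrite [X in Num.sqrt X]mulrC [leRHS]mulrC.
have := forallP disc S => /forallP /(_ T); rewrite /comparable_sets S0 T0 (ltW ST) (ltW TS)/=.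
by move=> /ltW.
Qed.

(** A - P is the noise minus the diagonal of P, which is of size b N / n. *)
Lemma tame_opnorm (delta theta M eta : R) w :
  0 < delta -> theta = delta / d -> 2 <= M ->
  2 * (6 * delta * M ^+ 2 + d / M) + b / n%:R <= eta ->
  tame delta theta w -> opnorm_le (A w - P) (eta * N).
Proof.
move=> d0 thE M2 etaE tw m Y; have dd := degree_bound_gt0.
have M0 : 0 < M by exact: lt_le_trans M2.
have n0 : 0 < n%:R :> R by rewrite ltr0n.
have deg : degrees_ok w by case/andP: tw.
have alpha0 : 0 <= delta * N by rewrite mulr_ge0 ?ltW.
pose h := 6 * (delta * N) * M ^+ 2 + d * N / M.
have h0 : 0 <= h.
  by rewrite addr_ge0 ?divr_ge0 ?mulr_ge0 ?sqr_ge0 ?(ltW d0) ?(ltW N_gt0) ?(ltW M0) ?(ltW dd).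
have opW : opnorm_le (W w) (2 * h).
  apply: opnorm_le_of_bilinear => // x y.
  apply: bilinear_discrepancy => //; first exact: tame_discrepancy thE tw.
    by move=> i; exact: noise_row_le.
  move=> j; under eq_bigr do rewrite noiseC//.
  exact: noise_row_le.
pose D : 'rV[R]_n := \row_i P i i.
have -> : A w - P = W w - diag_mx D.
  apply/matrixP => i j; rewrite !mxE; case: eqVneq => [<-|_].
    by rewrite mulr1n /conf_edge ltnn.
  by rewrite mulr0n subr0.
rewrite mulmxBl (le_trans (fnormB _ _))//.
have opD : fnorm (diag_mx D *m Y) <= pmax * fnorm Y.
  apply: fnorm_diag_le => // i j _; rewrite mxE ger0_norm ?mean_ge0//.
  by rewrite mxE B_max.
rewrite (le_trans (lerD (opW _ Y) opD))// -mulrDl ler_wpM2r ?fnorm_ge0//.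
have -> : pmax = b / n%:R * N.
  by rewrite mulrAC -pmaxE mulrAC divff ?mul1r// lt0r_neq0.
apply: le_trans (ler_wpM2r (ltW N_gt0) etaE); rewrite /h.
rewrite le_eqVlt; apply/orP; left; apply/eqP; field.
by rewrite !lt0r_neq0.
Qed.

(** Leading eigenvectors of some tame graph that agrees with w away from vertex i.
    By construction they do not depend on the edges at i, and one exists as soon
    as w itself is tame and has leading eigenvectors. *)
Definition surrogate_spec (delta theta : R) (i : 'I_n) (w : conf) :
    set 'M[R]_(n, K) :=
  [set X | exists w', [/\ agree_off i w w', tame delta theta w' &
                          top_eigenvectors (A w') X]].

Definition surrogate delta theta i w : 'M[R]_(n, K) :=
  xget 0 (surrogate_spec delta theta i w).

Lemma surrogate_off delta theta i w w' :
  agree_off i w w' -> surrogate delta theta i w = surrogate delta theta i w'.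
Proof.
move=> ww'; rewrite /surrogate; congr xget; apply/seteqP.
split=> X [v [wv tv vX]]; exists v; split=> // [e e1 e2].
  by rewrite -ww'// wv.
by rewrite ww'// wv.
Qed.

Lemma top_eigenvectors_orthonormal (M : 'M[R]_n) (U : 'M[R]_(n, K)) :
  top_eigenvectors M U -> U^T *m U = 1%:M.
Proof. by move=> [V [l [f [V1 _ fI _ ->]]]]; exact: colsub_orthonormal. Qed.

Lemma surrogate_col delta theta i w r :
  \sum_j surrogate delta theta i w j r ^+ 2 <= 1.
Proof.
rewrite /surrogate; case: xgetP => [X -> [w' [_ _ /top_eigenvectors_orthonormal X1]]|_].
  have /matrixP/(_ r r) := X1; rewrite !mxE eqxx mulr1n => <-.
  by apply: ler_sum => j _; rewrite !mxE expr2.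
by rewrite big1// => j _; rewrite mxE expr0n.
Qed.

Definition independent_rows_ok (delta theta eps : R) (w : conf) : bool :=
  [forall i : 'I_n, forall r : 'I_K,
    `|\sum_j W w i j * surrogate delta theta i w j r| <
    eps * N * ((Num.sqrt n%:R)^-1 + max_row (surrogate delta theta i w))].

Definition good (delta theta eps : R) (w : conf) : bool :=
  tame delta theta w && independent_rows_ok delta theta eps w.

End GoodConfigurations.

Section UnionBound.
Context {R : realType} (n K : nat) (c : 'I_n -> 'I_K) (B : 'M[R]_K) (pmax : R).
Hypothesis B01 : forall r s, 0 <= B r s <= 1.
Hypothesis B_max : forall r s, B r s <= pmax.
Hypothesis B_sym : B^T = B.
Context (b N : R).
Hypothesis b_ge1 : 1 <= b.
Hypothesis N_gt0 : 0 < N.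
Hypothesis pmaxE : n%:R * pmax = b * N.
Hypothesis pmax0 : 0 <= pmax.

Lemma sum_powerset (y : R) : \sum_(S : {set 'I_n}) y ^+ #|S| = (1 + y) ^+ n.
Proof.
transitivity (\prod_(i : 'I_n) (y + 1)); last by rewrite prodr_const card_ord addrC.
rewrite bigA_distr; apply: eq_bigr => S _.
by rewrite -big_mkcond/= prodr_const.
Qed.

(** The sum is (1 + y) ^ n - 1 <= exp (n y) - 1. *)
Lemma sum_nonempty_sets_le (y : R) : 0 <= y -> 2 * (n%:R * y) <= 1 ->
  \sum_(S : {set 'I_n} | (0 < #|S|)%N) y ^+ #|S| <= 2 * (n%:R * y).
Proof.
move=> y0 ny; have E := sum_powerset y.
rewrite (bigD1 (finset.set0 : {set 'I_n}))//= cards0 expr0 in E.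
have -> : \sum_(S : {set 'I_n} | (0 < #|S|)%N) y ^+ #|S| = (1 + y) ^+ n - 1.
  by rewrite -E addrAC subrr add0r; apply: eq_bigl => S; rewrite card_gt0.
have : (1 + y) ^+ n <= expR (n%:R * y).
  rewrite expRM_natl lerXn2r ?nnegrE ?expR_ge0 ?addr_ge0//.
  exact: expR_ge1Dx.
have ny0 : 0 <= n%:R * y by rewrite mulr_ge0.
have := @expR_le_quad R (n%:R * y); rewrite -ler_pdivlMl// in ny.
rewrite mulr1 in ny => /(_ ny); nra.
Qed.

(** For comparable sizes the geometric mean, in which the tail bound is expressed,
    dominates the arithmetic one, in which the number of sets is counted. *)
Lemma comparable_sets_sqrt (theta : R) (S T : {set 'I_n}) : 0 < theta -> theta <= 1 ->
  comparable_sets theta S T ->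
  theta / 2 * (#|S| + #|T|)%:R <= Num.sqrt (#|S|%:R * #|T|%:R).
Proof.
move=> t0 t1 /and4P[_ _ TS ST].
rewrite -ler_sqr ?nnegrE ?sqrtr_ge0 ?mulr_ge0 ?divr_ge0 ?(ltW t0)//.
rewrite sqr_sqrtr ?mulr_ge0// natrD.
have s0 : 0 <= #|S|%:R :> R by []; have u0 : 0 <= #|T|%:R :> R by [].
move: s0 u0 TS ST; move: (#|S|%:R) (#|T|%:R) => s u s0 u0 us su.
have h1 := ler_wpM2r u0 us; have h2 := ler_wpM2r s0 su.
have h3 : theta ^+ 2 * (s * u) <= 1 * (s * u).
  by rewrite ler_wpM2r ?mulr_ge0// expr_le1// (ltW t0).
have -> : (theta / 2 * (s + u)) ^+ 2 =
  (theta ^+ 2 * u * u + theta ^+ 2 * s * s + 2 * (theta ^+ 2 * (s * u))) / 4 by field.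
rewrite (mulrC u s) in h2; lra.
Qed.

(** A vertex, or a vertex and a column, fails with probability at most 2 y. A
    comparable pair (S, T) fails with probability at most 2 y ^ (|S| + |T|), which
    factors over S and T. *)
Lemma not_good_le (delta theta eps y : R) :
  0 < delta -> delta <= 2 * b -> 0 < theta -> theta <= 1 ->
  0 < eps -> eps <= 4 * b -> 0 <= y -> 2 * (n%:R * y) <= 1 ->
  expR (- N) <= y -> expR (- (eps ^+ 2 / (16 * b) * N)) <= y ->
  expR (- (delta ^+ 2 / (16 * b) * N * (theta / 2))) <= y ->
  bprob (edge_prob c B) (fun w => ~~ good c B b N delta theta eps w) <=
    (10 + 2 * K%:R) * (n%:R * y).
Proof.
move=> d0 db t0 t1 e0 eb y0 ny yN ye yd.
have ep01 := edge_prob01 c B01.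
set Pr := bprob _.
pose bad1 i (w : conf n) := 2 * (b + 1) * N <= `|\sum_j noise c B w i j|.
pose bad2 (ST : {set 'I_n} * {set 'I_n}) (w : conf n) :=
  delta * N * Num.sqrt (#|ST.1|%:R * #|ST.2|%:R) <=
  `|\sum_(i in ST.1) \sum_(j in ST.2) noise c B w i j|.
pose X (i : 'I_n) (w : conf n) : 'M[R]_(n, K) := surrogate c B b N delta theta i w.
pose bad3 (ir : 'I_n * 'I_K) (w : conf n) :=
  eps * N * ((Num.sqrt n%:R)^-1 + max_row (X ir.1 w)) <=
  `|\sum_j noise c B w ir.1 j * X ir.1 w j ir.2|.
pose ev1 w := [exists i, xpredT i && bad1 i w].
pose ev2 w := [exists ST, comparable_sets theta ST.1 ST.2 && bad2 ST w].
pose ev3 w := [exists ir, xpredT ir && bad3 ir w].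
have split : Pr (fun w => ~~ good c B b N delta theta eps w) <= Pr ev1 + Pr ev2 + Pr ev3.
  apply: le_trans (lerD (bprobU ep01 ev1 ev2) (lexx _)).
  apply: le_trans (bprobU ep01 _ _); apply: sub_bprob => // w.
  rewrite /good /tame !negb_and => /orP[/orP[]|].
  - rewrite negb_forall => /existsP[i]; rewrite -leNgt => h.
    by apply/orP; left; apply/orP; left; apply/existsP; exists i.
  - rewrite negb_forall => /existsP[S]; rewrite negb_forall => /existsP[T].
    rewrite negb_imply -leNgt => h.
    by apply/orP; left; apply/orP; right; apply/existsP; exists (S, T).
  - rewrite negb_forall => /existsP[i]; rewrite negb_forall => /existsP[r].
    rewrite -leNgt => h.
    by apply/orP; right; apply/existsP; exists (i, r).
have P1 : Pr ev1 <= 2 * (n%:R * y).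
  rewrite (le_trans (bprob_exists ep01 _ _))//.
  apply: (@le_trans _ _ (\sum_(i < n) 2 * y)).
    apply: ler_sum => i _.
    apply: (@le_trans _ _ (2 * expR (- N))); last by rewrite ler_pM2l.
    exact: (degree_tail c B01 B_max B_sym pmaxE pmax0 i).
  by rewrite sumr_const card_ord -[leLHS]mulr_natl mulrCA.
have P3 : Pr ev3 <= 2 * K%:R * (n%:R * y).
  rewrite (le_trans (bprob_exists ep01 _ _))//.
  apply: (@le_trans _ _ (\sum_(ir : 'I_n * 'I_K) 2 * y)).
    apply: ler_sum => ir _.
    apply: (@le_trans _ _ (2 * expR (- (eps ^+ 2 / (16 * b) * N)))).
      apply: (leave_one_out_tail c B01 B_max B_sym b_ge1 pmaxE pmax0
        (i := ir.1) (r := ir.2) (X := X ir.1)) => //.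
        by move=> w w' /(surrogate_off c B b N delta theta).
      by move=> w; exact: surrogate_col.
    by rewrite ler_pM2l.
  rewrite sumr_const card_prod !card_ord -[leLHS]mulr_natl natrM.
  by rewrite le_eqVlt; apply/orP; left; apply/eqP; ring.
have P2 : Pr ev2 <= 8 * (n%:R * y).
  rewrite (le_trans (bprob_exists ep01 _ _))//.
  apply: (@le_trans _ _ (\sum_(ST : {set 'I_n} * {set 'I_n} | comparable_sets theta ST.1 ST.2)
      2 * (y ^+ #|ST.1| * y ^+ #|ST.2|))).
    apply: ler_sum => -[S T] /= ST.
    apply: (@le_trans _ _ (2 * expR (- (delta ^+ 2 / (16 * b) * N *
        Num.sqrt (#|S|%:R * #|T|%:R))))).
      exact: (discrepancy_tail c B01 B_max B_sym b_ge1 pmaxE pmax0 S T d0 db).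
    rewrite ler_pM2l// -exprD.
    apply: (@le_trans _ _ (expR (- (delta ^+ 2 / (16 * b) * N * (theta / 2))) ^+ (#|S| + #|T|))).
      rewrite -expRM_natl ler_expR mulrN lerN2 -mulrA.
      rewrite mulrCA -mulrA ler_wpM2l ?divr_ge0 ?sqr_ge0 ?mulr_ge0 ?(le_trans _ b_ge1)//.
      rewrite mulrCA ler_pM2l//.
      by rewrite mulrC; exact: comparable_sets_sqrt.
    by rewrite lerXn2r ?nnegrE ?expR_ge0.
  rewrite -mulr_sumr.
  apply: (@le_trans _ _ (2 * ((2 * (n%:R * y)) * (2 * (n%:R * y))))).
    rewrite ler_pM2l//.
    apply: le_trans (ler_pM _ _ (sum_nonempty_sets_le y0 ny) (sum_nonempty_sets_le y0 ny)).
    - rewrite big_distrlr/= pair_big/=.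
      rewrite [leRHS](bigID (fun ST => comparable_sets theta ST.1 ST.2))/=.
      rewrite (eq_bigl (fun ST : {set 'I_n} * {set 'I_n} =>
        (0 < #|ST.1|)%N && (0 < #|ST.2|)%N && comparable_sets theta ST.1 ST.2)).
        rewrite lerDl; apply: sumr_ge0 => ST _.
        by rewrite mulr_ge0 ?exprn_ge0.
      move=> -[S T] /=; rewrite /comparable_sets.
      by case: (0 < #|S|)%N; case: (0 < #|T|)%N.
    - by apply: sumr_ge0 => S _; rewrite exprn_ge0.
    - by apply: sumr_ge0 => S _; rewrite exprn_ge0.
  have ny0 : 0 <= n%:R * y by rewrite mulr_ge0.
  nra.
rewrite (le_trans split)//; lra.
Qed.

End UnionBound.

(** * Good configurations are recovered *)

(** With these constants the bootstrapped row bound is at most 3 / 50 mu lo,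
    while clustering tolerates anything below mu lo / 16. *)
Lemma bootstrap_constants (R : realFieldType) (mu kap b tau beta N lo : R) :
  0 < mu -> mu <= 1 -> 0 < kap -> kap <= 1 -> 1 <= b -> 0 < N -> 0 <= tau -> 0 <= beta ->
  tau <= mu * kap / 300 -> beta <= mu * kap ^+ 2 / (300 * b) * N ->
  kap * N / 2 <= lo ->
  beta <= lo / 2 /\
  tau * N + beta * (2 * (b * N + tau * N) / lo) <= lo * (3 / 50 * mu).
Proof.
move=> mu0 mu1 kap0 kap1 b1 N0 tau0 beta0 tau_le beta_le lo_ge.
have b0 : 0 < b by exact: lt_le_trans b1.
have lo0 : 0 < lo by apply: lt_le_trans lo_ge; rewrite divr_gt0// mulr_gt0.
have mk1 : mu * kap <= 1 by rewrite mulr_ile1// ltW.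
have mk : mu * kap <= kap by rewrite ler_piMl// ltW.
have bV : b^-1 <= 1 by rewrite invf_le1.
have small : mu * kap ^+ 2 / (300 * b) <= mu * kap / 300.
  have -> : mu * kap ^+ 2 / (300 * b) = mu * kap / 300 * (kap * b^-1).
    by field; rewrite lt0r_neq0.
  apply: ler_piMr; first by rewrite divr_ge0 ?ler0n// mulr_ge0// ltW.
  by rewrite mulr_ile1 ?invr_ge0// ltW.
have small_le := ler_wpM2r (ltW N0) small.
have mkN := ler_wpM2r (ltW N0) mk.
have beta_lo : beta <= lo / 2.
  by move: beta_le small_le lo_ge mkN; rewrite expr2; lra.
split=> //.
have tau_b : tau <= b by lra.
have frac : 2 * (b * N + tau * N) / lo <= 8 * b / kap.
  rewrite ler_pdivrMr//; apply: (@le_trans _ _ (8 * b / kap * (kap * N / 2))).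
    have -> : 8 * b / kap * (kap * N / 2) = 2 * (b * N + b * N).
      by field; rewrite lt0r_neq0.
    by rewrite ler_pM2l// lerD2l ler_wpM2r// ltW.
  by rewrite ler_wpM2l// divr_ge0 ?mulr_ge0 ?ltW.
have prod : beta * (2 * (b * N + tau * N) / lo) <= 8 * mu * kap * N / 300.
  apply: (@le_trans _ _ (mu * kap ^+ 2 / (300 * b) * N * (8 * b / kap))).
    apply: ler_pM => //.
    by rewrite divr_ge0 ?mulr_ge0 ?addr_ge0 ?mulr_ge0// ltW.
  rewrite le_eqVlt; apply/orP; left; apply/eqP; field.
  by rewrite !lt0r_neq0.
have tN := ler_wpM2r (ltW N0) tau_le.
have lo_mu := ler_wpM2r (ltW mu0) lo_ge.
move: prod tN lo_mu; move: (beta * _) => x; lra.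
Qed.

Section GoodRecovery.
Context {R : realType} (n K : nat) (c : 'I_n -> 'I_K) (B : 'M[R]_K) (pmax : R).
Hypothesis B01 : forall r s, 0 <= B r s <= 1.
Hypothesis B_max : forall r s, B r s <= pmax.
Hypothesis B_sym : B^T = B.
Context (b N : R).
Hypothesis b_ge1 : 1 <= b.
Hypothesis N_gt0 : 0 < N.
Hypothesis pmaxE : n%:R * pmax = b * N.
Hypothesis pmax0 : 0 <= pmax.
Hypothesis n_gt0 : (0 < n)%N.
Context (mu kap : R).
Hypothesis mu_gt0 : 0 < mu.
Hypothesis mu_le1 : mu <= 1.
Hypothesis block_ge : forall r, mu * n%:R <= (block_size c r)%:R.
Hypothesis B_unit : B \in unitmx.
Hypothesis K_gt0 : (0 < K)%N.
Hypothesis kap_gt0 : 0 < kap.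
Hypothesis kap_le1 : kap <= 1.
Hypothesis kapP : kap * N * fnorm (mean_pinv c B) <= 1.

Local Notation P := (mean_adj c B).
Local Notation W := (noise c B).
Local Notation A := (@conf_adj R n).
Local Notation d := (degree_bound b).
Local Notation s := (Num.sqrt (n%:R : R))^-1.

Context (delta theta eps eta M : R).
Hypothesis delta_gt0 : 0 < delta.
Hypothesis thetaE : theta = delta / d.
Hypothesis M_ge2 : 2 <= M.
Hypothesis eta_gt0 : 0 < eta.
Hypothesis etaP : 2 * (6 * delta * M ^+ 2 + d / M) + b / n%:R <= eta.
Hypothesis eta_le : 16 * K%:R * eta <= kap.
Hypothesis eps_gt0 : 0 < eps.
Hypothesis epsP : b / n%:R <= K%:R * eps.

Let C := 8 * d / kap.
Let tau := 2 * K%:R * eps.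
Hypothesis tau_le : tau <= mu * kap / 300.
Hypothesis beta_le : 2 * tau * (1 + C) + eta * C <= mu * kap ^+ 2 / (300 * b).

Let n0 : 0 < n%:R :> R. Proof. by rewrite ltr0n. Qed.
Let b_gt0 : 0 < b. Proof. exact: lt_le_trans b_ge1. Qed.
Let d_gt0 : 0 < d. Proof. exact: degree_bound_gt0 b_ge1. Qed.
Let K1 : 1 <= K%:R :> R. Proof. by rewrite ler1n. Qed.
Let s_gt0 : 0 < s. Proof. by rewrite invr_gt0 sqrtr_gt0. Qed.
Let tau_ge0 : 0 <= tau. Proof. by rewrite /tau !mulr_ge0// ltW. Qed.
Let C_ge0 : 0 <= C. Proof. by rewrite /C divr_ge0 ?mulr_ge0 ?ltW. Qed.
Let eta_le16 : 16 * eta <= kap.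
Proof.
have := ler_wpM2r (ltW eta_gt0) K1; have := eta_le; rewrite -mulrA; lra.
Qed.

Lemma tame_split w (X : 'M[R]_(n, K)) : tame c B b N delta theta w ->
  top_eigenvectors (A w) X ->
  exists l, spectral_split (A w) X l (kap * N - eta * N) (eta * N).
Proof.
move=> tw [V [lambda [f [V1 AV fI top ->]]]]; exists (colsub f lambda).
apply: (@top_eigenvectors_split _ _ _ _ P _ _ _ (membership c) (membership c *m B)) => //.
- exact: conf_adj_sym.
- exact: mean_adjE.
- by rewrite mulr_ge0// ltW.
- exact: (tame_opnorm B01 B_max B_sym b_ge1 N_gt0 pmaxE pmax0 n_gt0 delta_gt0
    thetaE M_ge2 etaP tw).
- exact: (membership_inj mu_gt0 block_ge n_gt0).
- move=> y; apply: (mean_adj_ge mu_gt0 block_ge n_gt0 B_sym B_unit) => //.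
  by rewrite mulr_ge0// ltW.
Qed.

(** Only the entries in row i and column i differ, and these are edges at i. *)
Lemma agree_off_diff (i : 'I_n) (w w' : conf n) :
  degrees_ok c B b N w -> degrees_ok c B b N w' -> agree_off i w w' ->
  \sum_a \sum_b `|(A w' - A w) a b| <= 4 * d * N.
Proof.
move=> dw dw' ww'.
have zero a j : a != i -> j != i -> (A w' - A w) a j = 0.
  move=> ai ji; rewrite !mxE /conf_edge -(ww' (a, j)) -?(ww' (j, a))//.
  exact: subrr.
have le_entry a j : `|(A w' - A w) a j| <= A w' a j + A w a j.
  have := conf_adj_ge0 (R := R) w a j; have := conf_adj_ge0 (R := R) w' a j.
  rewrite [X in `|X|]mxE [X in _ + X]mxE ler_norml => ? ?.
  by apply/andP; split; lra.
have row_le : \sum_j `|(A w' - A w) i j| <= 2 * d * N.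
  apply: (@le_trans _ _ (\sum_j A w' i j + \sum_j A w i j)).
    by rewrite -big_split; apply: ler_sum => j _; exact: le_entry.
  have := degree_le B01 B_max b_ge1 N_gt0 pmaxE i dw.
  have := degree_le B01 B_max b_ge1 N_gt0 pmaxE i dw'; lra.
have sym a j : (A w' - A w) a j = (A w' - A w) j a.
  by rewrite !mxE (conf_edgeC w') (conf_edgeC w).
rewrite (bigD1 i)//= (_ : 4 * d * N = 2 * d * N + 2 * d * N); last by ring.
rewrite lerD//; apply: le_trans row_le.
rewrite [leRHS](bigD1 i)//= ler_wpDl//; apply: ler_sum => a ai.
rewrite (bigD1 i)//= big1 ?addr0 => [|j ji]; last by rewrite zero// normr0.
by rewrite sym.
Qed.

Lemma fnorm_le_sum k (u : 'rV[R]_k) : fnorm u <= \sum_r `|u 0 r|.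
Proof.
rewrite -fnorm_trmx (le_trans (fnorm_le_rows _))//; apply: ler_sum => r _.
by rewrite /fnorm !big_ord1 !mxE sqrtr_sqr.
Qed.

Lemma surrogate_row_le (i : 'I_n) (w : conf n) m :
  independent_rows_ok c B b N delta theta eps w ->
  (forall j, fnorm (row j (surrogate c B b N delta theta i w)) <= m) ->
  fnorm (row i ((A w - P) *m surrogate c B b N delta theta i w)) <= tau * N * (s + m).
Proof.
set X := surrogate _ _ _ _ _ _ _ _ => ok Xm.
have m0 : 0 <= m := le_trans (fnorm_ge0 _) (Xm i).
have rE : row i (A w - P) = row i (W w) - P i i *: delta_mx 0 i.
  apply/rowP => j; rewrite !mxE [j == i]eq_sym; case: eqVneq => [<-|_].
    by rewrite /conf_edge ltnn mulr1.
  by rewrite mulr0 subr0.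
rewrite row_mul rE mulmxBl -scalemxAl -rowE -row_mul.
rewrite (le_trans (fnormB _ _))// fnormZ.
have -> : tau * N * (s + m) = K%:R * (eps * N * (s + m)) + K%:R * (eps * N * (s + m)).
  by rewrite /tau; ring.
rewrite lerD//.
  rewrite (le_trans (fnorm_le_sum _))// mulr_natl -[X in _ <= _ *+ X]card_ord -sumr_const.
  apply: ler_sum => r _; rewrite !mxE.
  have /forallP/(_ r)/ltW := forallP ok i; rewrite -/X => /le_trans; apply.
  rewrite ler_wpM2l ?mulr_ge0 ?(ltW eps_gt0) ?(ltW N_gt0)// lerD2l.
  exact: max_row_lub.
have pE : pmax = b / n%:R * N by rewrite mulrAC -pmaxE mulrAC divff ?mul1r// lt0r_neq0.
apply: (@le_trans _ _ (pmax * m)).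
  apply: ler_pM => //; first exact: fnorm_ge0.
  by rewrite mxE ger0_norm; [exact: B_max|have /andP[] := B01 (c i) (c i)].
rewrite pE mulrA; apply: (@le_trans _ _ (K%:R * eps * N * (s + m))); last first.
  by rewrite !mulrA.
apply: ler_pM => //; rewrite ?mulr_ge0 ?(ltW N_gt0) ?divr_ge0 ?(ltW b_gt0)//.
  by rewrite ler_wpM2r// ltW.
by rewrite lerDr ltW.
Qed.

Lemma fnorm_row_mean i : fnorm (row i P) <= b * N * s.
Proof.
have -> : b * N * s = Num.sqrt n%:R * pmax.
  rewrite -pmaxE mulrAC -{1}(sqr_sqrtr (ltW n0)) expr2 mulfK//.
  by rewrite lt0r_neq0// sqrtr_gt0.
rewrite -ler_sqr ?nnegrE ?fnorm_ge0 ?mulr_ge0 ?sqrtr_ge0// exprMn.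
rewrite (sqr_sqrtr (ltW n0)) sqr_fnorm big_ord1 mulr_natl -[X in _ <= _ *+ X]card_ord.
rewrite -sumr_const; apply: ler_sum => j _; rewrite !mxE.
have /andP[p0 _] := B01 (c i) (c j).
by rewrite lerXn2r ?nnegrE.
Qed.

(** The surrogate of a good w exists since w itself qualifies, which provides the
    matrix X of the leave-one-out bound. *)
Lemma good_recovery (w : conf n) (chat : 'I_n -> 'I_K) :
  good c B b N delta theta eps w -> spectral_clustering (A w) chat ->
  exact_recovery c chat.
Proof.
move=> /andP[tw ok] [U [v [top km chatP]]].
have [l sU] := tame_split tw top.
have dw : degrees_ok c B b N w by case/andP: tw.
have Wh w' := tame_opnorm (c := c) (w := w') B01 B_max B_sym b_ge1 N_gt0 pmaxE pmax0 n_gt0 delta_gt0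
    thetaE M_ge2 etaP.
pose lo := kap * N - eta * N; pose hi := eta * N.
have hi0 : 0 < hi by rewrite mulr_gt0.
have kN0 : 0 < kap * N by rewrite mulr_gt0.
have hi_le : 16 * hi <= kap * N by rewrite mulrA ler_wpM2r// ltW.
have loE : lo = kap * N - hi by [].
have lo_ge : kap * N / 2 <= lo by lra.
have lo0 : 0 < lo by lra.
pose beta := 2 * (tau * N) * (1 + C) + hi * C.
have betaE : beta = N * (2 * tau * (1 + C) + eta * C) by rewrite /beta /hi; ring.
have beta0 : 0 <= beta.
  have tN0 : 0 <= tau * N := mulr_ge0 tau_ge0 (ltW N_gt0).
  have C10 : 0 <= 1 + C by rewrite addr_ge0.
  by rewrite /beta addr_ge0 ?(mulr_ge0 (mulr_ge0 _ tN0) C10) ?(mulr_ge0 (ltW hi0) C_ge0).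
have beta_le' : beta <= mu * kap ^+ 2 / (300 * b) * N.
  by rewrite betaE mulrC ler_wpM2r// ltW.
have boot u : (forall j, fnorm (row j U) <= u) ->
    forall i, fnorm (row i ((A w - P) *m U)) <= tau * N * s + beta * u.
  move=> Uu i.
  have [w' [ww' tw' topX]] : surrogate_spec c B b N delta theta i w
      (surrogate c B b N delta theta i w).
    by apply: (xgetPex (T := 'M[R]_(n, K))); exists U; exists w; split.
  have [l' sX] := tame_split tw' topX.
  have dw' : degrees_ok c B b N w' by case/andP: tw'.
  rewrite (_ : tau * N * s + beta * u =
    tau * N * (s + 2 * (1 + C) * u) + hi * (C * u)); last by rewrite /beta; ring.
  apply: (leave_one_out_row (g := kap * N / 2) (conf_adj_sym w) (conf_adj_sym w')
    sU sX (Wh _ tw) (Wh _ tw') _ _ _ _ C_ge0 _ _ _ Uu).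
  - by rewrite divr_gt0.
  - exact: ltW.
  - exact: ltW.
  - by rewrite mulr_ge0// ltW.
  - rewrite -/hi; lra.
  - rewrite -/hi; have Khi : 16 * K%:R * hi <= kap * N.
      by rewrite /hi mulrA ler_wpM2r// ltW.
    rewrite (_ : 16 * hi ^+ 2 * K%:R = 16 * K%:R * hi * hi); last by ring.
    apply: le_trans (ler_wpM2r (ltW hi0) Khi) _.
    rewrite (_ : (_ / 2) ^+ 2 = kap * N * (kap * N / 4)); last by field.
    by rewrite ler_pM2l//; lra.
  - apply: le_trans (agree_off_diff dw dw' ww') _.
    rewrite /C le_eqVlt; apply/orP; left; apply/eqP; field.
    by rewrite lt0r_neq0.
  - by move=> m; exact: surrogate_row_le.
have bN0 : 0 <= b * N by rewrite mulr_ge0 ?ltW.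
have tN0 : 0 <= tau * N by rewrite mulr_ge0// ltW.
have [beta_lo row_const] := bootstrap_constants mu_gt0 mu_le1 kap_gt0 kap_le1 b_ge1
  N_gt0 tau_ge0 beta0 tau_le beta_le' lo_ge.
have rows := row_bootstrap sU lo0 (ltW s_gt0) beta0 bN0 tN0 fnorm_row_mean beta_lo boot.
pose e := 3 / 50 * mu * s.
have rows_le i : fnorm (row i ((A w - P) *m U)) <= lo * e.
  apply: le_trans (rows i) _; rewrite /e [leRHS]mulrA.
  exact: (ler_wpM2r (ltW s_gt0)).
have kapQ : 8 * hi * fnorm (mean_pinv c B) <= 1.
  apply: le_trans kapP; rewrite ler_wpM2r ?fnorm_ge0//; lra.
apply: (recovery_of_row_bounds mu_gt0 block_ge n_gt0 B_sym B_unit K_gt0 mu_le1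
  (conf_adj_sym w) sU (Wh _ tw) (ltW hi0) lo0 kapQ _ _ rows_le _ km chatP).
- rewrite -/hi -/lo; lra.
- by rewrite /e; have := mulr_gt0 mu_gt0 s_gt0; lra.
- by rewrite /e; have := mulr_gt0 mu_gt0 s_gt0; lra.
Qed.

End GoodRecovery.

(** * From the probability space to configurations *)

Section Transfer.
Context d (T : measurableType d) (R : realType) (Pm : probability T R).
Context (n K : nat) (c : 'I_n -> 'I_K) (B : 'M[R]_K).
Context (E : 'I_n -> 'I_n -> {RV Pm >-> bool}).
Hypothesis B01 : forall r s, 0 <= B r s <= 1.
Hypothesis sbm : stochastic_block_model c B E.

Definition conf_of (x : T) : conf n :=
  [ffun e : 'I_n * 'I_n => (e.1 < e.2)%N && E e.1 e.2 x].

Lemma adjacencyE x : adjacency E x = conf_adj (conf_of x).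
Proof.
apply/matrixP => i j; rewrite !mxE /conf_edge !ffunE/=.
case: ltngtP => [//|ji|/val_inj <-] /=; first by rewrite (sbm_sym sbm).
by rewrite (sbm_diag sbm).
Qed.

Lemma edge_preimage_measurable i j (A : set bool) : measurable (E i j @^-1` A).
Proof.
have := @measurable_funP _ _ _ _ setT (E i j) measurableT A I.
by rewrite setTI.
Qed.

Lemma edge_probE (i j : 'I_n) b : (i < j)%N ->
  Pm (E i j @^-1` [set b]) = (coin (edge_prob c B) (i, j) b)%:E.
Proof.
move=> ij; have := sbm_law sbm ij [set b]; rewrite /distribution/= /pushforward => ->.
rewrite bernoulli_probE ?B01// !diracE /coin /edge_prob/= ij.
have in1 (a a' : bool) : (a \in [set a']) = (a == a').
  by apply/idP/eqP => [/set_mem|->] //; rewrite mem_set.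
by rewrite !in1; case: b => /=; rewrite ?mule1 ?mule0 ?adde0 ?add0e.
Qed.

Lemma conf_of_preimage (h : conf n) :
  conf_of @^-1` [set h] = \bigcap_(e in [set: 'I_n * 'I_n])
    [set x | (e.1 < e.2)%N && E e.1 e.2 x = h e].
Proof.
apply/seteqP; split => x /= => [<- e _ /=|xh]; first by rewrite ffunE.
by apply/ffunP => e; rewrite ffunE; exact: xh.
Qed.

Lemma conf_of_measurable (h : conf n) : measurable (conf_of @^-1` [set h]).
Proof.
rewrite conf_of_preimage; apply: fin_bigcap_measurable => // e _.
have -> : [set x | (e.1 < e.2)%N && E e.1 e.2 x = h e] =
    E e.1 e.2 @^-1` [set b | (e.1 < e.2)%N && b = h e] by [].
exact: edge_preimage_measurable.
Qed.

Lemma conf_of_prob (h : conf n) :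
  (Pm (conf_of @^-1` [set h]) <= (bweight (edge_prob c B) h)%:E)%E.
Proof.
pose X (e : 'I_n * 'I_n) := E e.1 e.2.
pose D := [set e : 'I_n * 'I_n | (e.1 < e.2)%N]%SET.
have [hD|] := boolP [forall e, (e \notin D) ==> ~~ h e]; last first.
  rewrite negb_forall => /existsP[e]; rewrite negb_imply negbK => /andP[eD he].
  have -> : conf_of @^-1` [set h] = classical_sets.set0.
    rewrite -subset0 => x /= xh; move: eD he; rewrite inE -xh ffunE.
    by move=> /negbTE ->.
  by rewrite measure0 lee_fin bweight_ge0//; exact: edge_prob01.
have -> : conf_of @^-1` [set h] =
    \bigcap_(e in [set` D]) (X e @^-1` [set h e]).
  rewrite conf_of_preimage; apply/seteqP; split => x /= xh e.
    by rewrite /= inE => eD; have := xh e I; rewrite /= eD.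
  move=> _ /=; case: (boolP (e \in D)) => eD.
    by have := xh e eD => /= ->; move: eD; rewrite inE => ->.
  have := forallP hD e; rewrite eD/= => /negbTE ->.
  by move: eD; rewrite inE => /negbTE ->.
rewrite (sbm_indep sbm (subxx D) (fun e : 'I_n * 'I_n => I : measurable [set h e])).
rewrite (eq_bigr (fun e : 'I_n * 'I_n => (coin (edge_prob c B) e (h e))%:E)) => [|[i j]]; last first.
  by rewrite inE /= => ij; exact: edge_probE.
rewrite prodEFin lee_fin /bweight [leRHS](bigID (mem D))/=.
rewrite [X in _ <= _ * X]big1 ?mulr1// => e eD.
have := forallP hD e; rewrite eD/= => /negbTE ->.
by move: eD; rewrite inE /coin /edge_prob => /negbTE ->; rewrite subr0.
Qed.

(** Recovery only depends on the configuration, so it is a finite union of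
    measurable events, each of probability at most its weight under the product
    law. *)
Lemma spectral_recovery_prob (good : pred (conf n)) (y : R) :
  (forall h, good h -> forall chat : 'I_n -> 'I_K,
     spectral_clustering (@conf_adj R n h) chat -> exact_recovery c chat) ->
  bprob (edge_prob c B) (fun h => ~~ good h) <= y ->
  ((1 - y)%:E <= Pm (spectral_recovery_event c E))%E.
Proof.
move=> goodP bad_le.
pose ok (h : conf n) := `[< forall chat : 'I_n -> 'I_K,
  spectral_clustering (@conf_adj R n h) chat -> exact_recovery c chat >].
have evE (Q : pred (conf n)) : [set x | Q (conf_of x)] =
    \bigcup_(h in [set h | Q h]) conf_of @^-1` [set h].
  apply/seteqP; split => [x Qx|x [h /= Qh xh]]; first by exists (conf_of x).
  by rewrite xh.
have mQ (Q : pred (conf n)) : measurable [set x | Q (conf_of x)].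
  rewrite evE; apply: fin_bigcup_measurable => [|h _]; first exact: finite_finset.
  exact: conf_of_measurable.
have -> : spectral_recovery_event c E = [set x | ok (conf_of x)].
  apply/seteqP; split => x /=.
    by move=> xok; apply/asboolP => chat; rewrite -adjacencyE; exact: xok.
  by move=> /asboolP xok chat; rewrite adjacencyE; exact: xok.
apply: (@le_trans _ _ (Pm [set x | good (conf_of x)])); last first.
  apply: le_measure; rewrite ?inE; [exact: mQ|exact: mQ|].
  by move=> x /= gx; apply/asboolP; exact: goodP.
have -> : [set x | good (conf_of x)] = ~` [set x | ~~ good (conf_of x)].
  by apply/seteqP; split => x /= => [-> //|/negP]; rewrite negbK.
rewrite probability_setC; last exact: (mQ (fun h => ~~ good h)).
rewrite EFinB leeB//.
apply: (@le_trans _ _ (bprob (edge_prob c B) (fun h => ~~ good h))%:E); last by rewrite lee_fin.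
rewrite /bprob -sumEFin (evE (fun h => ~~ good h)).
have -> : \bigcup_(h in [set h | ~~ good h]) conf_of @^-1` [set h] =
    \big[setU/classical_sets.set0]_(h | ~~ good h) (conf_of @^-1` [set h]).
  apply/seteqP; split => x.
    move=> [h /= gh xh]; rewrite (bigD1 h)//=; left; exact: xh.
  elim/big_ind : _ => //= [X Y HX HY [/HX|/HY]//|h gh xh].
  by exists h.
have : measurable (\big[setU/classical_sets.set0]_(h | ~~ good h) (conf_of @^-1` [set h]))
    /\ (Pm (\big[setU/classical_sets.set0]_(h | ~~ good h) (conf_of @^-1` [set h])) <=
        \sum_(h | ~~ good h) (bweight (edge_prob c B) h)%:E)%E; last by case.
elim/big_ind2 : _ => [|A a A' a' [mA PA] [mA' PA']|h _].
- by rewrite measure0.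
- split; first exact: measurableU.
  by rewrite (le_trans (measureU2 _ _ _))// leeD.
- by split; [exact: conf_of_measurable|exact: conf_of_prob].
Qed.

End Transfer.

(** * Choice of the constants *)

Section Constants.
Context {R : realType}.

(** eps, eta and delta are the noise levels of the leave-one-out, operator norm
    and discrepancy bounds. They are fixed by the model, and the constant of the
    theorem is then read off from the exponents of the tail bounds. *)
Lemma exists_constants (K : nat) (b mu kap : R) :
  (0 < K)%N -> 1 <= b -> 0 < mu -> mu <= 1 -> 0 < kap -> kap <= 1 ->
  exists eps eta M delta theta : R,
  [/\ [/\ 0 < eps, eps <= 4 * b, 0 < eta & 2 <= M],
      [/\ 0 < delta, delta <= 2 * b, theta = delta / degree_bound b, 0 < theta & theta <= 1],
      2 * (6 * delta * M ^+ 2 + degree_bound b / M) <= 2 / 3 * eta,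
      16 * K%:R * eta <= kap
    & 2 * K%:R * eps <= mu * kap / 300 /\
      2 * (2 * K%:R * eps) * (1 + 8 * degree_bound b / kap) +
      eta * (8 * degree_bound b / kap) <= mu * kap ^+ 2 / (300 * b)].
Proof.
move=> K0 b1 mu0 mu1 kap0 kap1; set d := degree_bound b.
have d6 : 6 <= d by rewrite /d /degree_bound; lra.
have d0 : 0 < d by exact: lt_le_trans d6.
have b0 : 0 < b by exact: lt_le_trans b1.
have K1 : 1 <= K%:R :> R by rewrite ler1n.
have Kp : 0 < K%:R :> R by rewrite ltr0n.
have mk0 : 0 < mu * kap by rewrite mulr_gt0.
have mk1 : mu * kap <= 1 by rewrite mulr_ile1// ltW.
set C := 8 * d / kap; have C0 : 0 <= C by rewrite divr_ge0 ?mulr_ge0 ?ltW.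
have C1 : 0 < 1 + C by rewrite ltr_pwDl.
pose r := kap / b; have r0 : 0 < r by rewrite divr_gt0.
have r1 : r <= 1 by rewrite ler_pdivrMr// mul1r (le_trans kap1).
pose t := mu * kap * r / 300.
have tE : mu * kap ^+ 2 / (300 * b) = t by rewrite /t /r; field; rewrite lt0r_neq0.
have mkr0 : 0 < mu * kap * r by rewrite mulr_gt0.
have mkr_le : mu * kap * r <= mu * kap by rewrite ler_piMr// ltW.
have t0 : 0 < t by rewrite /t; lra.
have t_mk : t <= mu * kap / 300 by rewrite /t; lra.
have mk_k : mu * kap <= kap by rewrite ler_piMl// ltW.
have KC0 : 0 < K%:R * (1 + C) by rewrite mulr_gt0.
have KC1 : 1 <= K%:R * (1 + C).
  by rewrite -[leLHS]mulr1 ler_pM// lerDl.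
pose u := t / (K%:R * (1 + C)).
have u0 : 0 < u by rewrite divr_gt0.
have KuE : K%:R * u * (1 + C) = t by rewrite /u; field; rewrite !lt0r_neq0.
have ut : u <= t by rewrite ler_pdivrMr// ler_peMr// ltW.
have Ku0 : 0 < K%:R * u by rewrite mulr_gt0.
have Kut : K%:R * u <= t.
  by rewrite -[leRHS]KuE ler_peMr ?(ltW Ku0)// lerDl.
have uCt : u * C <= t.
  rewrite -[leRHS]KuE; apply: ler_pM => //; [exact: ltW| |by rewrite lerDr].
  by rewrite ler_peMl// ltW.
clearbody C t u.
have [eta etaE] : exists eta, eta = u / 16 by exists (u / 16).
have eta0 : 0 < eta by lra.
have eta1 : eta <= 1 by lra.
have q0 : 0 < d / eta := divr_gt0 d0 eta0.
have [M ME] : exists M, M = 2 + 6 * (d / eta) by exists (2 + 6 * (d / eta)).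
have M2 : 2 <= M by lra.
have M0 : 0 < M by exact: lt_le_trans M2.
have M4 : 4 <= M ^+ 2 by rewrite expr2; nra.
have Msq0 : 0 < 36 * M ^+ 2 by lra.
have [delta deltaE] : exists delta, delta = eta / (36 * M ^+ 2).
  by exists (eta / (36 * M ^+ 2)).
have delta0 : 0 < delta by rewrite deltaE; exact: divr_gt0.
have delta_eta : delta <= eta.
  rewrite deltaE ler_pdivrMr//; apply: ler_peMr; [exact: ltW|lra].
exists (u / 8), eta, M, delta, (delta / d); split.
- by split=> //; lra.
- split=> //; [lra|by rewrite divr_gt0|by rewrite ler_pdivrMr// mul1r; lra].
- have -> : 6 * delta * M ^+ 2 = eta / 6 by rewrite deltaE; field; rewrite lt0r_neq0.
  have : d / M <= eta / 6.
    rewrite ler_pdivrMr//; have : 0 <= eta / 6 * 2 by lra.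
    have -> : eta / 6 * M = eta / 6 * 2 + d by rewrite ME; field; rewrite lt0r_neq0.
    lra.
  lra.
- rewrite etaE; move: Kut; rewrite -!mulrA; lra.
split; first by lra.
rewrite tE.
have -> : 2 * (2 * K%:R * (u / 8)) * (1 + C) = t / 2 by rewrite -KuE; field.
by rewrite etaE; lra.
Qed.

End Constants.

Section FailureProbability.
Context {R : realType}.

(** The two spare powers of n pay for the union bound over the vertices and for the
    constant factor. *)
Lemma polynomial_tail (n K : nat) (q : R) : 0 < q -> (10 + 2 * K <= n)%N ->
  let y := expR (- ((q + 2) * ln n%:R)) in
  (10 + 2 * K%:R) * (n%:R * y) <= n%:R `^ (- q) /\ 2 * (n%:R * y) <= 1.
Proof.
move=> q0 Kn y.
have n0 : 0 < n%:R :> R by rewrite ltr0n; apply: leq_trans Kn; rewrite addn_gt0.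
have n1 : 1 <= n%:R :> R by rewrite ler1n -(ltr0n R).
have L0 : 0 <= ln (n%:R : R) by rewrite ln_ge0.
have yn : n%:R * (n%:R * y) = expR (- (q * ln n%:R)).
  have nE : expR (ln n%:R) = n%:R :> R by rewrite lnK ?posrE.
  by rewrite /y -{1 2}nE -!expRD; congr expR; ring.
have powE : n%:R `^ (- q) = expR (- (q * ln n%:R)).
  by rewrite /powR gt_eqF// mulNr.
have ny0 : 0 <= n%:R * y by rewrite mulr_ge0 ?expR_ge0.
have le1 : (10 + 2 * K%:R) * (n%:R * y) <= expR (- (q * ln n%:R)).
  by rewrite -yn ler_wpM2r// -(natrM _ 2) -natrD ler_nat.
split; first by rewrite powE.
apply: (@le_trans _ _ ((10 + 2 * K%:R) * (n%:R * y))).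
  by rewrite ler_wpM2r//; have := ler0n R K; lra.
by rewrite (le_trans le1)// -[leRHS]expR0 ler_expR oppr_le0 mulr_ge0// ltW.
Qed.

Lemma exp_tail (a N z x : R) : 0 <= N -> z <= a -> x <= z * N ->
  expR (- (a * N)) <= expR (- x).
Proof.
by move=> N0 za xz; rewrite ler_expR lerN2 (le_trans xz)// ler_wpM2r.
Qed.

End FailureProbability.

(* The sequence eps is the rate at which n_r / n tends to pi_r. The threshold n0
   has to depend on it: nothing is assumed on the labels of a given n beyond
   this convergence, so no n0 could work for all label sequences at once.
   Neither c nor n0 depends on the labels themselves or on rho. *)
Theorem theorem5p2 (R : realType) (K : nat) (B0 : 'M[R]_K) (pi_ : 'I_K -> R)
    (q : R)
    (B0_sym : B0^T = B0)
    (B0_full_rank : \rank B0 = K)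
    (pi_gt0 : forall r, 0 < pi_ r)
    (pi_sum1 : \sum_r pi_ r = 1)
    (q_gt0 : 0 < q) :
  exists2 c : R, 0 < c &
  forall eps : nat -> R, eps @ \oo --> (0 : R) ->
  exists n0 : nat,
  forall (lab : forall n : nat, 'I_n -> 'I_K) (rho : nat -> R),
    (forall n r, `|(block_size (lab n) r)%:R / n%:R - pi_ r| <= eps n) ->
    (forall n, 0 < rho n) ->
    (forall n r s, 0 <= rho n * B0 r s <= 1) ->
  forall (n : nat) (d : measure_display) (T : measurableType d)
    (P : probability T R) (E : 'I_n -> 'I_n -> {RV P >-> bool}),
    stochastic_block_model (lab n) (rho n *: B0) E ->
    (n0 <= n)%N ->
    c * ln n%:R <= n%:R * rho n ->
    ((1 - n%:R `^ (- q))%:E <= P (spectral_recovery_event (lab n) E))%E.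
Proof.
have K_gt0 : (0 < K)%N.
  case: K B0 pi_ B0_sym B0_full_rank pi_gt0 pi_sum1 => // B0 p _ _ _.
  by rewrite big_ord0 => /eqP; rewrite eq_sym oner_eq0.
have B0_unit : B0 \in unitmx by rewrite -row_free_unit /row_free B0_full_rank.
pose b : R := 1 + \sum_r \sum_s `|B0 r s|.
have sum0 : 0 <= \sum_r \sum_s `|B0 r s| by do 2![apply: sumr_ge0 => ? _].
have b_ge1 : 1 <= b by rewrite lerDl.
have B0_b r s : B0 r s <= b.
  apply: (le_trans (ler_norm _)); rewrite /b (bigD1 r)//= (bigD1 s)//=.
  have := @sumr_ge0 R _ (index_enum 'I_K) (fun i => i != s) (fun i => `|B0 r i|).
  have s0 : 0 <= \sum_(i | i != r) \sum_s0 `|B0 i s0| by do 2![apply: sumr_ge0 => ? _].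
  by move=> /(_ (fun i _ => normr_ge0 _)); lra.
pose pmin : R := \big[Num.min/1]_r pi_ r.
have pmin0 : 0 < pmin.
  by apply: (big_ind (fun t : R => 0 < t)) => // x y x0 y0; rewrite lt_min x0.
have pmin_le r : pmin <= pi_ r by rewrite /pmin (bigD1 r)//= ge_min lexx.
pose mu := pmin / 2.
have mu_gt0 : 0 < mu by rewrite divr_gt0.
have mu_le1 : mu <= 1.
  have : pmin <= 1.
    apply: (big_ind (fun t : R => t <= 1)) => // [x y x1 _|r _].
      by rewrite ge_min x1.
    rewrite -pi_sum1 (bigD1 r)//= lerDl; apply: sumr_ge0 => i _; exact: ltW.
  by rewrite /mu; lra.
pose F := K%:R * (1 + fnorm (invmx B0)).
have F_gt0 : 0 < F by rewrite mulr_gt0 ?ltr0n// ltr_pwDl// fnorm_ge0.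
pose kap := mu / (mu + F).
have kap_gt0 : 0 < kap by rewrite divr_gt0// addr_gt0.
have kap_le1 : kap <= 1 by rewrite ler_pdivrMr ?addr_gt0// mul1r lerDl ltW.
have kapF : kap * F <= mu.
  rewrite mulrAC ler_pdivrMr ?addr_gt0// ler_pM2l// lerDr ltW//.
have [e [eta [M [delta [theta [[e0 eb eta0 M2] [delta0 delta_b thetaE th0 th1]
  op_le eta_le [tau_le beta_le]]]]]]] :=
  exists_constants K_gt0 b_ge1 mu_gt0 mu_le1 kap_gt0 kap_le1.
have b_gt0 : 0 < b by exact: lt_le_trans b_ge1.
pose z1 := e ^+ 2 / (16 * b); pose z2 := delta ^+ 2 / (16 * b) * (theta / 2).
pose z := Num.min 1 (Num.min z1 z2).
have z_gt0 : 0 < z.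
  have b16 : 0 < 16 * b by rewrite mulr_gt0.
  have z1_gt0 : 0 < z1 by rewrite divr_gt0// exprn_gt0.
  have z2_gt0 : 0 < z2.
    by apply: mulr_gt0; rewrite divr_gt0// exprn_gt0.
  by rewrite !lt_min ltr01 z1_gt0.
(* N >= c log n makes every exponent of the tail bounds at least (q + 2) log n *)
exists ((q + 2) / z); first by rewrite divr_gt0// addr_gt0.
move=> eps eps0.
have [n1 epsP] : exists n1, forall n, (n1 <= n)%N -> eps n <= mu.
  have /cvgrPdist_le /(_ mu mu_gt0) [n1 _ n1P] := eps0.
  exists n1 => n n1n; have := n1P n n1n; rewrite /= sub0r normrN.
  exact: le_trans (ler_norm _).
pose n2 := Num.bound (3 * b / eta); pose n3 := Num.bound (b / (K%:R * e)).
exists (maxn n1 (maxn (10 + 2 * K) (maxn n2 n3))).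
move=> lab rho labP rho0 rhoB n d T P E sbm.
rewrite !geq_max => /and4P[nn1 nK nn2 nn3] c_le.
have n_gt0 : (0 < n)%N by apply: leq_trans nK; rewrite addn_gt0.
have nR : 0 < n%:R :> R by rewrite ltr0n.
have Ke0 : 0 < K%:R * e by rewrite mulr_gt0 ?ltr0n.
pose N := n%:R * rho n; have N0 : 0 < N by rewrite mulr_gt0.
pose B := rho n *: B0.
have B01 r s : 0 <= B r s <= 1 by rewrite mxE.
have B_max r s : B r s <= b * rho n by rewrite mxE mulrC ler_wpM2r// ltW.
have B_sym : B^T = B by rewrite /B linearZ/= B0_sym.
have rho_unit : rho n \is a GRing.unit by rewrite unitfE lt0r_neq0.
have B_unit : B \in unitmx by rewrite unitmxZ.
have pmaxE : n%:R * (b * rho n) = b * N by rewrite mulrCA.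
have pmax0 : 0 <= b * rho n by rewrite mulr_ge0// ltW.
have blk r : mu * n%:R <= (block_size (lab n) r)%:R.
  have := labP n r; rewrite ler_norml => /andP[+ _].
  have := epsP n nn1; have := pmin_le r; rewrite -ler_pdivlMr//.
  by rewrite /mu; lra.
have kapP : kap * N * fnorm (mean_pinv (lab n) B) <= 1.
  have := fnorm_mean_pinv B mu_gt0 blk n_gt0.
  move=> /(ler_wpM2l (ltW (mulr_gt0 kap_gt0 N0))) /le_trans; apply.
  rewrite invmxZ// fnormZ ger0_norm ?invr_ge0 ?(ltW (rho0 n))//.
  have -> : kap * N * ((rho n)^-1 * fnorm (invmx B0) * K%:R / (mu * n%:R)) =
    kap * (K%:R * fnorm (invmx B0)) / mu.
    by rewrite /N; field; rewrite !lt0r_neq0.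
  rewrite ler_pdivrMr// mul1r; apply: le_trans kapF; rewrite ler_pM2l//.
  by rewrite /F ler_pM2l ?ltr0n// lerDr.
have bn_eta : b / n%:R <= eta / 3.
  have : 3 * b / eta < n%:R.
    apply: (lt_le_trans (archi_boundP _)); last by rewrite ler_nat.
    by rewrite divr_ge0 ?mulr_ge0 ?ltW.
  by rewrite ltr_pdivrMr// => h; rewrite ler_pdivrMr//; lra.
have bn_e : b / n%:R <= K%:R * e.
  have : b / (K%:R * e) < n%:R.
    apply: (lt_le_trans (archi_boundP _)); last by rewrite ler_nat.
    by rewrite divr_ge0 ?ltW.
  by rewrite ltr_pdivrMr// => h; rewrite ler_pdivrMr// mulrC ltW.
have op_le' : 2 * (6 * delta * M ^+ 2 + degree_bound b / M) + b / n%:R <= eta by lra.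
have [tail1 tail2] := polynomial_tail q_gt0 nK.
have zN : (q + 2) * ln n%:R <= z * N.
  by rewrite (mulrC z) -ler_pdivrMr// mulrAC.
have [z_1 z_z1 z_z2] : [/\ z <= 1, z <= z1 & z <= z2].
  by split; rewrite /z !ge_min lexx ?orbT.
apply: (@le_trans _ _ (1 - (10 + 2 * K%:R) *
    (n%:R * expR (- ((q + 2) * ln n%:R))))%:E).
  by rewrite lee_fin lerD2l lerN2.
apply: (spectral_recovery_prob B01 sbm
  (good := good (lab n) B b N delta theta e)) => [h hP chat|].
  exact: (good_recovery B01 B_max B_sym b_ge1 N0 pmaxE pmax0 n_gt0 mu_gt0 mu_le1 blk
    B_unit K_gt0 kap_gt0 kap_le1 kapP delta0 thetaE M2 eta0 op_le' eta_le e0 bn_e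
    tau_le beta_le hP).
apply: (not_good_le (lab n) B01 B_max B_sym b_ge1 N0 pmaxE pmax0) => //.
- by rewrite -[X in - X]mul1r; exact: (exp_tail (ltW N0) z_1 zN).
- exact: (exp_tail (ltW N0) z_z1 zN).
- by rewrite mulrAC; exact: (exp_tail (ltW N0) z_z2 zN).
Qed.
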